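(* Let $H\in(0,1)$ and let $Q_{B_H}(t)=\sup_{-\infty<s\le t}\left(B_H(t)-B_H(s)-(t-s)\right)$, $t\ge0$, where $B_H$ is a fractional Brownian motion on $\mathbb{R}$ with Hurst parameter $H$. Let $A=\frac{1}{1-H}\left(\frac{H}{1-H}\right)^{-H}$. Then $$\limsup_{t\to\infty}\frac{Q_{B_H}(t)}{(\log t)^{\frac{1}{2(1-H)}}}=\left(\frac{2}{A^2}\right)^{\frac{1}{2(1-H)}}\quad\text{a.s.}$$
   Context: $B_H=\{B_H(t):t\in\mathbb{R}\}$ is a fractional Brownian motion with Hurst parameter $H$: a centered Gaussian process (with continuous sample paths) with covariance $\mathrm{Cov}(B_H(t),B_H(s))=\frac12\left(|t|^{2H}+|s|^{2H}-|t-s|^{2H}\right)$. *)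

(* Defs.v *)
From mathcomp Require Import all_boot all_order all_algebra.
From mathcomp Require Import all_classical all_reals all_analysis.

Set Implicit Arguments.
Unset Strict Implicit.
Unset Printing Implicit Defensive.

Import Order.TTheory GRing.Theory Num.Theory.
Import numFieldNormedType.Exports.

Local Open Scope classical_set_scope.
Local Open Scope ring_scope.

(* Degenerate (constant) laws count as Gaussian; they are listed separately
   because normal_prob m 0 is, by convention, not the Dirac mass at m. *)
Definition gaussian_rv (d : measure_display) (T : measurableType d)
    (R : realType) (P : probability T R) (X : T -> R) : Prop :=
  exists m : R,
    (exists2 s : R, 0 < s &
       forall A : set R, measurable A -> P (X @^-1` A) = normal_prob m s A) \/
    (forall A : set R, measurable A -> P (X @^-1` A) = \d_m A).

Definition gaussian_process (d : measure_display) (T : measurableType d)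
    (R : realType) (P : probability T R) (I : Type)
    (X : I -> {RV P >-> R}) : Prop :=
  forall (n : nat) (t : 'I_n -> I) (a : 'I_n -> R),
    gaussian_rv P (fun w : T => \sum_(i < n) a i * X (t i) w).

Definition fractional_brownian_motion (d : measure_display)
    (T : measurableType d) (R : realType) (P : probability T R)
    (H : R) (B : R -> {RV P >-> R}) : Prop :=
  [/\ gaussian_process B,
      forall t : R, ('E_P[B t] = 0)%E,
      forall t s : R, covariance P (B t) (B s) =
        (2^-1 * (`|t| `^ (2 * H) + `|s| `^ (2 * H) - `|t - s| `^ (2 * H)))%:E
    & forall w : T, continuous (fun t : R => B t w)].

(* The supremum is taken in the extended reals, so that +oo is allowed on the
   (null) event where the set is unbounded. *)
Definition storage (d : measure_display) (T : measurableType d)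
    (R : realType) (P : probability T R) (B : R -> {RV P >-> R})
    (t : R) (w : T) : \bar R :=
  ereal_sup [set (B t w - B s w - (t - s))%:E | s in [set s : R | s <= t]].

Definition const_A (R : realType) (H : R) : R :=
  (1 - H)^-1 * (H / (1 - H)) `^ (- H).

(* Main.v *)
(** The law enters only through the moment generating functions of linear
combinations of values of B, which are those of Gaussians.

Upper bound.  By weighted AM-GM, const_A H * u^(1-H) * y^H <= u + y, so Chernoff
gives P(B(r) - B(r-y) > u + y) <= exp(-A^2 u^(2(1-H)) / 2) for every lag y > 0.
Summing over integer lags, a small loss in the constant pays for the summation,
while the oscillation over unit intervals (dyadic chaining) has a Gaussian tail
exp(-c u^2), negligible as 2 > 2(1-H).  Borel-Cantelli over integer times follows.

Lower bound.  The optimal lag is l = H/(1-H) * u.  Take n times spaced by n^e and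
increments X_i of lag l, normalized to variance 1, whose correlations tend to 0
polynomially in n, and put W = (1/n) sum_i exp(a X_i - a^2/2) 1{|X_i - a| <= e a}
with a^2 < 2 log n.  Then E (W-1)^2 tends to 0, and it bounds the probability that
no X_i exceeds (1-e) a.  Since this probability tends to 0 there are infinitely
many successes a.s.; neither independence nor a comparison inequality is needed. *)

Require Import Defs.
From HB Require Import structures.
From mathcomp Require Import all_boot all_order all_algebra.
From mathcomp Require Import all_classical all_reals all_analysis.
From mathcomp Require Import measurable_realfun.
From mathcomp Require Import ring lra.

Set Implicit Arguments.
Unset Strict Implicit.
Unset Printing Implicit Defensive.

Import Order.TTheory GRing.Theory Num.Theory.
Import numFieldNormedType.Exports.

Local Open Scope classical_set_scope.
Local Open Scope ring_scope.

(** * Gaussian moment generating functions *)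

(** Completing the square in the exponent: an exponential tilt shifts the mean by l s^2. *)
Lemma normal_pdf_tilt (R : realType) (m s l x : R) : s != 0 ->
  expR (l * x) * normal_pdf m s x
  = expR (l * m + l ^+ 2 * s ^+ 2 / 2) * normal_pdf (m + l * s ^+ 2) s x.
Proof.
move=> s0; rewrite !normal_pdfE// /normal_fun mulrCA [RHS]mulrCA -!expRD.
congr (_ * expR _); field; exact: s0.
Qed.

(** The abstract Radon-Nikodym derivative and [normal_pdf] have the same integral over every
    measurable set, hence agree almost everywhere. *)
Lemma ge0_integral_normal_prob (R : realType) (m s : R) (f : R -> \bar R) :
  measurable_fun setT f -> (forall x, (0 <= f x)%E) ->
  (\int[normal_prob m s]_x f x =
   \int[lebesgue_measure]_x (f x * (normal_pdf m s x)%:E))%E.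
Proof.
move=> mf f0.
rewrite -(Radon_Nikodym_SigmaFinite.change_of_variables
  (normal_prob_dominates m s))//.
set h := Radon_Nikodym_SigmaFinite.f _ _.
have dom := normal_prob_dominates m s.
have hint := Radon_Nikodym_SigmaFinite.f_integrable dom.
apply: ae_eq_integral => //.
- apply: emeasurable_funM => //; exact: (measurable_int _ hint).
- apply: emeasurable_funM => //; apply/measurable_EFinP.
  exact: measurable_normal_pdf.
- apply: ae_eqe_mul2l; apply: integral_ae_eq => //.
  + by apply/measurable_EFinP; exact: measurable_normal_pdf.
  + by move=> E _ mE; rewrite -Radon_Nikodym_SigmaFinite.f_integral.
Qed.

Lemma normal_prob_mgf (R : realType) (m s l : R) : s != 0 ->
  (\int[normal_prob m s]_x (expR (l * x))%:E
   = (expR (l * m + l ^+ 2 * s ^+ 2 / 2))%:E)%E.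
Proof.
move=> s0; rewrite ge0_integral_normal_prob.
- under eq_integral do rewrite -EFinM normal_pdf_tilt// EFinM.
  rewrite integralZl//; last exact: integrable_normal_pdf.
  by rewrite integral_normal_pdf mule1.
- by apply/measurable_EFinP; do 2 apply: measurableT_comp => //.
- by move=> x; rewrite lee_fin expR_ge0.
Qed.

(** The Dirac laws are the case v = 0. That m and v are the mean and the variance is only shown in
    [gaussian_moments]. *)
Lemma gaussian_mgf (d : measure_display) (T : measurableType d)
    (R : realType) (P : probability T R) (X : T -> R) :
  measurable_fun [set: T] X -> gaussian_rv P X ->
  exists m v : R, 0 <= v /\
    forall l, ('E_P[fun w => expR (l * X w)])%E
      = (expR (l * m + l ^+ 2 * v / 2))%:E.
Proof.
move=> mX [m mXP].
pose Y : {RV P >-> measurableTypeR R} :=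
  HB.pack X (isMeasurableFun.Build _ _ _ (measurableTypeR R) X mX).
have mexp l : measurable_fun [set: R] (fun x => (expR (l * x))%:E).
  by apply/measurable_EFinP; do 2 apply: measurableT_comp => //.
have push l : ('E_P[fun w => expR (l * X w)])%E
    = (\int[distribution P Y]_x (expR (l * x))%:E)%E.
  by rewrite unlock ge0_integral_distribution//; exact: mexp.
case: mXP => [[s s0 Xs]|Xs].
  exists m, (s ^+ 2); split; first exact: sqr_ge0.
  move=> l; rewrite push -normal_prob_mgf ?gt_eqF//.
  by apply: eq_measure_integral => A mA _; exact: Xs.
exists m, 0; split => // l; rewrite push mulr0 mul0r addr0.
transitivity (\int[\d_(m : measurableTypeR R)]_x (expR (l * x))%:E)%E.
  by apply: eq_measure_integral => A mA _; exact: Xs.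
rewrite integral_dirac//; last exact: mexp.
by rewrite diracT mul1e.
Qed.

(** Bundling integrability with a real value lets linear combinations and comparisons be computed
    without side conditions on finiteness. *)
Definition has_expectation (d : measure_display) (T : measurableType d)
    (R : realType) (P : probability T R) (X : T -> R) (e : R) : Prop :=
  P.-integrable [set: T] (EFin \o X) /\ ('E_P[X] = e%:E)%E.

Section HasExpectation.
Context {d : measure_display} {T : measurableType d} {R : realType}.
Variable P : probability T R.
Implicit Types (X Y : T -> R) (a b c : R).

Lemma ge0_has_expectation X a :
  measurable_fun [set: T] X -> (forall w, 0 <= X w) -> ('E_P[X] = a%:E)%E ->
  has_expectation P X a.
Proof.
move=> mX X0 EX; split => //; apply/integrableP; split.
  exact/measurable_EFinP.
rewrite unlock in EX.
by under eq_integral do rewrite /= ger0_norm//; rewrite EX ltry.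
Qed.

Lemma has_expectation_cst a : has_expectation P (fun=> a) a.
Proof.
split; first exact: finite_measure_integrable_cst.
exact: expectation_cst.
Qed.

Lemma has_expectationD X Y a b : has_expectation P X a ->
  has_expectation P Y b -> has_expectation P (fun w => X w + Y w) (a + b).
Proof.
move=> [iX EX] [iY EY]; split.
  exact: (integrableD measurableT iX iY).
by rewrite (@expectationD _ _ _ P X Y) ?EX ?EY//; exact/Lfun1_integrable.
Qed.

Lemma has_expectationZ k X a : has_expectation P X a ->
  has_expectation P (fun w => k * X w) (k * a).
Proof.
move=> [iX EX]; split.
  exact: (integrableZl measurableT k iX).
have -> : (fun w => k * X w) = (k \o* X) by apply/funext => w /=; rewrite mulrC.
by rewrite expectationZl ?EX//; exact/Lfun1_integrable.
Qed.

Lemma has_expectation_le X Y a b : has_expectation P X a ->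
  has_expectation P Y b -> (forall w, X w <= Y w) -> a <= b.
Proof.
move=> [iX EX] [iY EY] XY; rewrite -lee_fin -EX -EY unlock.
by apply: le_integral => // w _; rewrite lee_fin.
Qed.

Lemma has_expectation_sum (I : Type) (r : seq I) (X : I -> T -> R) (a : I -> R) :
  (forall i, has_expectation P (X i) (a i)) ->
  has_expectation P (fun w => \sum_(i <- r) X i w) (\sum_(i <- r) a i).
Proof.
move=> Xa; elim: r => [|i r IHr].
  under eq_fun do rewrite big_nil; rewrite big_nil; exact: has_expectation_cst.
under eq_fun do rewrite big_cons; rewrite big_cons.
exact: has_expectationD.
Qed.

Lemma has_expectation_indic (A : set T) : measurable A ->
  has_expectation P (\1_A : T -> R) (fine (P A)).
Proof.
move=> mA; split; last first.
  by rewrite expectation_indic// fineK// fin_num_measure.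
by apply: integrable_indic.
Qed.

Lemma prob_le_expectation (A : set T) X a : measurable A ->
  has_expectation P X a -> (forall w, 0 <= X w) -> (forall w, A w -> 1 <= X w) ->
  (P A <= a%:E)%E.
Proof.
move=> mA Xa X0 X1; rewrite -(@fineK _ (P A)) ?fin_num_measure// lee_fin.
apply: has_expectation_le (has_expectation_indic mA) Xa _ => w.
by rewrite indicE; case: (boolP (w \in A)) => [/set_mem/X1|_].
Qed.

End HasExpectation.

(** * Mean and variance read off the generating function *)

Lemma nonneg_derive_le (R : realType) (f df : R -> R) (y : R) :
  (forall x : R, is_derive x (1 : R) f (df x)) -> (forall x, 0 <= x -> 0 <= df x) ->
  0 <= y -> f 0 <= f y.
Proof.
move=> fdf df0 y0.
have cf : continuous f.
  by move=> x; apply/differentiable_continuous/derivable1_diffP; have [] := fdf x.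
have [c] := MVT_segment y0 (fun x _ => fdf x) (continuous_subspaceT cf).
rewrite in_itv/= => /andP[c0 _] fE.
by rewrite -subr_ge0 fE subr0 mulr_ge0// df0.
Qed.

Lemma sinh_ge (R : realType) (y : R) : 0 <= y -> y *+ 2 <= expR y - expR (- y).
Proof.
move=> y0.
have := @nonneg_derive_le R (fun y => expR y - expR (- y) - y *+ 2)
  (fun y => expR y + expR (- y) - 2) y _ _ y0.
rewrite oppr0 subrr mul0rn subr0 subr_ge0; apply.
  move=> x; apply: is_derive_eq; rewrite /GRing.scale/=; ring.
by move=> x x0; have := expR_ge1Dx x; have := expR_ge1Dx (- x); lra.
Qed.

(** In other words tanh y <= y: the derivative of y cosh y - sinh y is y sinh y. *)
Lemma sinh_le (R : realType) (y : R) : 0 <= y ->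
  expR y - expR (- y) <= y * (expR y + expR (- y)).
Proof.
move=> y0.
have := @nonneg_derive_le R
  (fun y => y * (expR y + expR (- y)) - (expR y - expR (- y)))
  (fun y => y * (expR y - expR (- y))) y _ _ y0.
rewrite oppr0 mul0r !subrr subr_ge0; apply.
  move=> x; apply: is_derive_eq; rewrite /GRing.scale/=; ring.
by move=> x x0; rewrite mulr_ge0// subr_ge0 ler_expR; lra.
Qed.

(* The two bounds sandwich z^2 between linear combinations of exponentials that
   agree to second order: this reads the variance off the generating function. *)
Lemma cosh_bounds (R : realType) (z : R) :
  let g := (expR z + expR (- z)) / 2 - 1 in
  [/\ 0 <= g, z ^+ 2 / 2 <= g & g - g ^+ 2 / 2 <= z ^+ 2 / 2].
Proof.
wlog z0 : z / 0 <= z.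
  move=> h; have [/h//|zN] := leP 0 z.
  have := h (- z); rewrite opprK sqrrN [expR (- z) + _]addrC; apply.
  by rewrite oppr_ge0 ltW.
have y0 : 0 <= z / 2 by lra.
set g := _ - 1 => /=.
have := sinh_ge y0; have := sinh_le y0.
set E := expR (z / 2); set F := expR (- (z / 2)).
have EF : E * F = 1 by rewrite /E /F -expRD subrr expR0.
(* The identity cosh z - 1 = 2 sinh^2 (z/2) reduces the claims to the two bounds on sinh at z/2. *)
have -> : g = (E - F) ^+ 2 / 2.
  have -> : (E - F) ^+ 2 = E ^+ 2 + F ^+ 2 - 2 by rewrite sqrrB EF; ring.
  rewrite /g /E /F -!expRM_natl -[in LHS](divfK (x := 2) _ z)//.
  by rewrite mulrN [2%:R * _]mulrC; field.
have E0 : 0 < E := expR_gt0 _; have F0 : 0 < F := expR_gt0 _.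
have S2 : (E + F) ^+ 2 = (E - F) ^+ 2 + 4.
  by rewrite sqrrD sqrrB EF; ring.
set S := E - F; rewrite -/S in S2 * => SC Sz.
have S0 : 0 <= S by lra.
have zS : z ^+ 2 <= S ^+ 2 by apply: lerXn2r; rewrite ?nnegrE; lra.
have Sz' : S ^+ 2 <= z ^+ 2 / 4 * (S ^+ 2 + 4).
  rewrite -S2; have -> : z ^+ 2 / 4 * (E + F) ^+ 2 = (z / 2 * (E + F)) ^+ 2.
    by field.
  by apply: lerXn2r; rewrite ?nnegrE//; apply: le_trans SC.
set Q := S ^+ 2 in zS Sz' *; have Q0 : 0 <= Q by apply: sqr_ge0.
split; [lra|lra|].
(* The claim is 4 Q - Q^2 <= 4 Z; it follows from 4 Q <= Z Q + 4 Z and Z Q <= Q^2. *)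
move: Sz' zS; set Z := z ^+ 2; move=> h1 h2.
nra.
Qed.

Section GaussianMoments.
Context {d : measure_display} {T : measurableType d} {R : realType}.
Variable P : probability T R.
Implicit Types (X : T -> R).

Lemma has_expectation_mgf X (m v : R) : measurable_fun [set: T] X ->
  (forall l, ('E_P[fun w => expR (l * X w)])%E
     = (expR (l * m + l ^+ 2 * v / 2))%:E) ->
  forall l, has_expectation P (fun w => expR (l * X w))
              (expR (l * m + l ^+ 2 * v / 2)).
Proof.
move=> mX Xm l; apply: ge0_has_expectation => //.
by do 2 apply: measurableT_comp => //.
Qed.

Lemma cosh_Lfun2 X a b : measurable_fun [set: T] X ->
  has_expectation P (fun w => expR (X w)) a ->
  has_expectation P (fun w => expR (- X w)) b -> X \in Lfun P 2%:E.
Proof.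
move=> mX Xa Xb.
rewrite inE; apply/andP; split; rewrite inE//=.
rewrite /finite_norm unlock poweR_lty//.
have [/integrableP[_ h] _] := has_expectationD Xa Xb.
apply: le_lt_trans h; apply: ge0_le_integral => //.
- by move=> w _; exact: poweR_ge0.
- apply/measurable_EFinP; apply: (measurableT_comp (measurable_powR _)) => //.
  exact: measurableT_comp.
- apply: measurableT_comp => //; apply/measurable_EFinP.
  by case: Xa Xb => /integrableP[/measurable_EFinP ? _] _
    [/integrableP[/measurable_EFinP ? _] _]; apply: measurable_funD.
- move=> w _; rewrite lee_fin powR_mulrn// real_normK ?num_real//.
  rewrite ger0_norm ?addr_ge0 ?expR_ge0//.
  by have [] := cosh_bounds (X w); lra.
Qed.

(** For the mean: exp(l X) >= 1 + l X gives l m + l^2 v / 2 >= 0 for all l, which forces m = 0. For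
    the second moment: [cosh_bounds] at l X squeezes it onto v as l tends to 0. *)
Lemma gaussian_moments X (m v : R) : measurable_fun [set: T] X -> 0 <= v ->
  (forall l, ('E_P[fun w => expR (l * X w)])%E
     = (expR (l * m + l ^+ 2 * v / 2))%:E) ->
  X \in Lfun P 2%:E /\
  (('E_P[X])%E = 0%E -> m = 0 /\ ('E_P[X ^+ 2])%E = v%:E).
Proof.
move=> mX v0 Xm; have mgf := has_expectation_mgf mX Xm.
have X2 : X \in Lfun P 2%:E.
  apply: (cosh_Lfun2 mX).
    by have := mgf 1; under eq_fun do rewrite mul1r; exact.
  by have := mgf (-1); under eq_fun do rewrite mulN1r; exact.
split => // EX.
have X1 : X \in Lfun P 1.
  by apply: Lfun_subset12 X2; exact: fin_num_measure.
have hX : has_expectation P X 0 by split => //; exact/Lfun1_integrable.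
have m0 : m = 0.
  have h l : 0 <= l * m + l ^+ 2 * v / 2.
    rewrite -ler_expR expR0.
    have := has_expectation_le
      (has_expectationD (has_expectation_cst P 1) (has_expectationZ l hX)) (mgf l).
    rewrite mulr0 addr0; apply => w; exact: expR_ge1Dx.
  have v1 : 0 < v + 1 by lra.
  (* Close to the minimizer -m/v; the added 1 covers v = 0. *)
  have := h (- m / (v + 1)).
  have -> : - m / (v + 1) * m + (- m / (v + 1)) ^+ 2 * v / 2
      = - (m ^+ 2 * ((v + 2) / (2 * (v + 1) ^+ 2))).
    by field; lra.
  rewrite oppr_ge0 pmulr_lle0 => [|]; last first.
    by rewrite divr_gt0// ?mulr_gt0 ?exprn_gt0//; lra.
  move=> m2; apply/eqP; rewrite -sqrf_eq0; apply/eqP/le_anti.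
  by rewrite m2 sqr_ge0.
split => //; subst m.
have iX2 := Lfun2_integrable_sqr X2.
set q := fine ('E_P[X ^+ 2])%E.
have hX2 : has_expectation P (fun w => X w ^+ 2) q.
  split => //; rewrite /q fineK// expectation_fin_num//.
  exact/Lfun1_integrable.
suff -> : v = q by case: hX2.
have q0 : 0 <= q.
  by apply: has_expectation_le (has_expectation_cst P 0) hX2 _ => w; exact: sqr_ge0.
have ub l : l ^+ 2 / 2 * q <= expR (l ^+ 2 * v / 2) - 1.
  have := has_expectation_le (has_expectationZ (l ^+ 2 / 2) hX2)
    (has_expectationD (has_expectation_cst P (- 1)) (has_expectationZ (1 / 2)
     (has_expectationD (mgf l) (mgf (- l))))).
  rewrite !mulr0 sqrrN add0r => /(_ _)/le_trans; apply; last by lra.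
  by move=> w; rewrite mulNr; have [] := cosh_bounds (l * X w); rewrite exprMn; lra.
(* With E F = 1, the lower bound g - g^2/2 expands to E + F - (E^2 + F^2)/8 - 7/4, where E^2 and F^2
   are exponentials at 2 l and -2 l. *)
have lb l : 2 * expR (l ^+ 2 * v / 2) - expR (4 * (l ^+ 2 * v / 2)) / 4 - 7 / 4
    <= l ^+ 2 / 2 * q.
  have := has_expectation_le
    (has_expectationD (has_expectation_cst P (- (7 / 4)))
      (has_expectationD (has_expectationD (mgf l) (mgf (- l)))
        (has_expectationZ (- (1 / 8))
           (has_expectationD (mgf (2 * l)) (mgf (- (2 * l)))))))
    (has_expectationZ (l ^+ 2 / 2) hX2).
  rewrite !mulr0 !sqrrN !add0r.
  have -> : (2 * l) ^+ 2 * v / 2 = 4 * (l ^+ 2 * v / 2) by field.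
  move=> h; apply: le_trans (h _); first by lra.
  move=> w; rewrite !mulNr -!mulrA.
  have [_ _] := cosh_bounds (l * X w).
  have e2 x : expR (2 * x) = expR x ^+ 2 by rewrite expRM_natl.
  have EF : expR (l * X w) * expR (- (l * X w)) = 1 by rewrite -expRD subrr expR0.
  rewrite -[- (2 * _)]mulrN !e2 exprMn.
  set E := expR (l * X w) in EF *; set F := expR _ in EF *.
  have -> : ((E + F) / 2 - 1) ^+ 2
    = (E ^+ 2 + F ^+ 2) / 4 + 1 / 2 * (E * F) - (E + F) + 1 by field.
  rewrite EF; lra.
have e_ub (t : R) : t < 1 -> expR t <= (1 - t)^-1.
  move=> t1; have := expR_ge1Dx (- t); rewrite expRN => h.
  by rewrite -[leLHS]invrK lef_pV2 ?posrE ?invr_gt0 ?expR_gt0//; lra.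
have [v00|v_neq0] := eqVneq v 0.
  have := ub 1; have := lb 1; rewrite v00 !mulr0 !mul0r mulr0 expR0; lra.
have v_gt0 : 0 < v by rewrite lt_neqAle eq_sym v_neq0.
(* Here l is chosen with l^2 v / 2 = t. Both bounds on t (q/v) equal t to first order. *)
have small (t : R) : 0 < t -> t < 1 / 4 ->
    t * (q / v) <= (1 - t)^-1 - 1 /\ 2 * t + 1 / 4 - (1 - 4 * t)^-1 / 4 <= t * (q / v).
  move=> t0 t4; have := ub (Num.sqrt (2 * t / v)); have := lb (Num.sqrt (2 * t / v)).
  rewrite sqr_sqrtr; last by rewrite divr_ge0//; lra.
  have -> : 2 * t / v * v / 2 = t by field.
  have -> : 2 * t / v / 2 * q = t * (q / v) by field.
  have t1 : t < 1 by lra.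
  have t41 : 4 * t < 1 by lra.
  have := e_ub t t1; have := e_ub (4 * t) t41; have := expR_ge1Dx t; lra.
set r := q / v in small.
have r0 : 0 <= r by rewrite divr_ge0// ltW.
suff r1 : r = 1 by rewrite -[RHS](divfK v_neq0) -/r r1 mul1r.
apply/eqP; rewrite eq_le; apply/andP; split; rewrite leNgt; apply/negP => rlt.
(* The two bounds force r - 1 <= t r if r > 1, and 1 - r <= 8 t if r < 1; in each case t is taken
   too small for that. *)
- pose t := (r - 1) / (8 * r).
  have t0 : 0 < t by rewrite divr_gt0//; lra.
  have tr : t * (8 * r) = r - 1 by rewrite /t divfK//; lra.
  have t4 : t < 1 / 4 by nra.
  have [h _] := small t t0 t4.
  have t1 : 0 < 1 - t by lra.
  have : (t * r + 1) * (1 - t) <= 1.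
    by rewrite -ler_pdivlMr// div1r; lra.
  nra.
- pose t := (1 - r) / 16.
  have t0 : 0 < t by rewrite /t; lra.
  have t4 : t < 1 / 4 by rewrite /t; lra.
  have [_ h] := small t t0 t4.
  have t1 : 0 < 1 - 4 * t by rewrite /t; lra.
  have : (8 * t + 1 - 4 * t * r) * (1 - 4 * t) <= 1.
    by rewrite -ler_pdivlMr// div1r; lra.
  have : r = 1 - 16 * t by rewrite /t; lra.
  move=> ->; have t16 : t <= 1 / 16 by rewrite /t; lra.
  have : 0 < 48 - 256 * t by lra.
  by move=> /(mulr_gt0 (mulr_gt0 t0 t0)); lra.
Qed.

(** With the variance as the only parameter, generating functions of linear combinations follow from
    the covariances by bilinearity. *)
Lemma gaussian_expR X : measurable_fun [set: T] X -> gaussian_rv P X ->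
  X \in Lfun P 2%:E /\
  forall v, ('E_P[X])%E = 0%E -> ('V_P[X])%E = v%:E ->
    has_expectation P (fun w => expR (X w)) (expR (v / 2)).
Proof.
move=> mX /(gaussian_mgf mX)[m [v [v0 mgf]]].
have [X2 mv] := gaussian_moments mX v0 mgf; split => // v' EX VX.
have [m0 EX2] := mv EX; subst m.
move: VX; rewrite varianceE// EX EX2 expe2 mule0 sube0 => -[<-].
have := has_expectation_mgf mX mgf 1.
by under eq_fun do rewrite mul1r; rewrite mulr0 add0r expr1n mul1r.
Qed.

End GaussianMoments.

(** * Fractional Brownian increments *)

(** The variogram: the variance of an increment of lag x. *)
Definition fbm_kernel (R : realType) (H x : R) : R := `|x| `^ (2 * H).

Section FBM.
Context {d : measure_display} {T : measurableType d} {R : realType}.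
Context {P : probability T R} {H : R} {B : R -> {RV P >-> R}}.
Hypothesis H_gt0 : 0 < H.
Hypothesis fbmB : fractional_brownian_motion H B.

Local Notation h := (fbm_kernel H).

Lemma fbm_Lfun2 t : (B t : T -> R) \in Lfun P 2%:E.
Proof.
have [gB _ _ _] := fbmB.
have := gB 1%N (fun=> t) (fun=> 1).
under eq_fun do rewrite big_ord1 mul1r.
by move=> /gaussian_expR; case.
Qed.

Lemma fbm_covariance t s :
  covariance P (B t) (B s) = ((h t + h s - h (t - s)) / 2)%:E.
Proof. by have [_ _ -> _] := fbmB; congr (_%:E); rewrite mulrC. Qed.

Lemma fbm_kernelC x y : h (x - y) = h (y - x).
Proof. by rewrite /fbm_kernel distrC. Qed.

(** The exponent is half the variance of the combination, and the factor of a b is twice the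
    covariance of the two increments. Pairs are all that a second moment argument asks for. *)
Lemma fbm_increment_expR (t s t' s' a b : R) :
  has_expectation P
    (fun w => expR (a * (B t w - B s w) + b * (B t' w - B s' w)))
    (expR ((a ^+ 2 * h (t - s) + b ^+ 2 * h (t' - s')
      + a * b * (h (t - s') + h (s - t') - h (t - t') - h (s - s'))) / 2)).
Proof.
have [gB mB _ _] := fbmB.
pose tt (i : 'I_4) := nth 0 [:: t; s; t'; s'] i.
pose aa (i : 'I_4) := nth 0 [:: a; - a; b; - b] i.
have := gB 4 tt aa.
have sumE w : \sum_(i < 4) aa i * B (tt i) w
    = a * (B t w - B s w) + b * (B t' w - B s' w).
  by rewrite !big_ord_recl big_ord0 /aa /tt /=; ring.
under eq_fun do rewrite sumE.
pose I1 : T -> R := B t \- B s; pose I2 : T -> R := B t' \- B s'.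
pose X1 : T -> R := a \o* I1; pose X2 : T -> R := b \o* I2.
have XE w : a * (B t w - B s w) + b * (B t' w - B s' w) = (X1 \+ X2) w.
  by rewrite /X1 /X2 /I1 /I2 /= mulrC [b * _]mulrC.
under eq_fun do rewrite XE; under [X in has_expectation _ X]eq_fun do rewrite XE.
have L2 := fbm_Lfun2.
have LI1 : I1 \in Lfun P 2%:E by rewrite rpredB ?L2// lee1n.
have LI2 : I2 \in Lfun P 2%:E by rewrite rpredB ?L2// lee1n.
have LX1 : X1 \in Lfun P 2%:E by rewrite Lfun_scale ?ler1n.
have LX2 : X2 \in Lfun P 2%:E by rewrite Lfun_scale ?ler1n.
have L1 Y : Y \in Lfun P 2%:E -> Y \in Lfun P 1.
  by apply: Lfun_subset12; exact: fin_num_measure.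
have mX : measurable_fun [set: T] (X1 \+ X2).
  by apply: measurable_funD; apply: measurable_funM => //; apply: measurable_funB.
(* By convention 0 to the power 0 is 1, so this rests on H > 0. *)
have h0 : h 0 = 0 by rewrite /fbm_kernel normr0 powR0// mulf_neq0// gt_eqF.
move=> /(gaussian_expR mX)[_]; apply.
- rewrite expectationD ?L1// !expectationZl ?L1// !expectationB ?L1//.
  by rewrite !mB !sube0 !mule0 adde0.
- rewrite varianceD// !varianceZ// covarianceZl; [|exact: L1|exact: L1|exact: Lfun2_mul_Lfun1].
  rewrite covarianceZr; [|exact: L1|exact: L1|exact: Lfun2_mul_Lfun1].
  have -> : ('V_P[I1])%E = (h (t - s))%:E.
    rewrite varianceB// /variance !fbm_covariance !subrr h0 -EFinM -!EFinD.
    by congr (_%:E); field.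
  have -> : ('V_P[I2])%E = (h (t' - s'))%:E.
    rewrite varianceB// /variance !fbm_covariance !subrr h0 -EFinM -!EFinD.
    by congr (_%:E); field.
  have -> : covariance P I1 I2
      = ((h (t - s') + h (s - t') - h (t - t') - h (s - s')) / 2)%:E.
    rewrite covarianceBl// ?covarianceBr// !fbm_covariance -!EFinB.
    by congr (_%:E); field.
  by rewrite -!EFinM -!EFinD; congr (_%:E); field.
Qed.

Lemma fbm_expR (t s a : R) :
  has_expectation P (fun w => expR (a * (B t w - B s w)))
    (expR (a ^+ 2 * h (t - s) / 2)).
Proof.
have := fbm_increment_expR t s 0 0 a 0.
under eq_fun do rewrite mul0r addr0.
by rewrite expr0n /= mulr0 !mul0r !addr0.
Qed.

Lemma fbm_measurable t s : measurable_fun [set: T] (fun w => B t w - B s w).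
Proof. by apply: measurable_funB. Qed.

Lemma fbm_measurable_gt (t s x : R) : measurable [set w | x < B t w - B s w].
Proof.
rewrite -[X in measurable X]setTI.
have -> : [set w | x < B t w - B s w] = (fun w => B t w - B s w) @^-1` `]x, +oo[.
  by apply/seteqP; split => w /=; rewrite in_itv/= andbT.
by apply: fbm_measurable.
Qed.

(** Chernoff's bound, at the parameter a = x / h(t - s) that minimizes -a x + a^2 h(t - s) / 2. *)
Lemma fbm_tail (t s x : R) : t != s -> 0 <= x ->
  (P [set w | (x < B t w - B s w)%R] <= (expR (- (x ^+ 2 / (2 * h (t - s)))))%:E)%E.
Proof.
move=> ts x0; pose a := x / h (t - s).
have h0 : 0 < h (t - s) by rewrite powR_gt0// normr_gt0 subr_eq0.
have a0 : 0 <= a by rewrite divr_ge0// ltW.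
have -> : expR (- (x ^+ 2 / (2 * h (t - s))))
    = expR (- (a * x)) * expR (a ^+ 2 * h (t - s) / 2).
  by rewrite -expRD; congr expR; rewrite /a; field; rewrite gt_eqF.
apply: (prob_le_expectation (fbm_measurable_gt t s x)
  (has_expectationZ _ (fbm_expR t s a))).
  by move=> w; rewrite mulr_ge0 ?expR_ge0.
move=> w /= /ltW xB; rewrite -expRD -expR0 ler_expR addrC subr_ge0.
by rewrite ler_wpM2l.
Qed.

End FBM.

(** * Real inequalities *)

Section RealInequalities.
Context {R : realType}.
Implicit Types (a b p q x y u H M : R).

(** Young's inequality with the conjugate exponents 1/p and 1/(1-p). *)
Lemma weighted_amgm p x y : 0 < p < 1 -> 0 <= x -> 0 <= y ->
  x `^ p * y `^ (1 - p) <= p * x + (1 - p) * y.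
Proof.
move=> /andP[p0 p1] x0 y0; have q0 : 0 < 1 - p by lra.
have := @conjugate_powR R (x `^ p) (y `^ (1 - p)) p^-1 (1 - p)^-1.
rewrite !powR_ge0 !invr_gt0 !invrK -!powRrM !mulfV ?gt_eqF// !powRr1//.
by rewrite subrKC [x * _]mulrC [y * _]mulrC; apply.
Qed.

Lemma powR_concave_tangent p y : 0 < p < 1 -> -1 <= y ->
  (1 + y) `^ p <= 1 + p * y.
Proof.
move=> p01 y1; have := @weighted_amgm p (1 + y) 1 p01.
by rewrite powR1 mulr1 => h; apply: le_trans (h _ _) _ => //; lra.
Qed.

Lemma gt0_powRD x p q : 0 < x -> x `^ (p + q) = x `^ p * x `^ q.
Proof. by move=> x0; rewrite powRD// (gt_eqF x0) implybT. Qed.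

Lemma powR_invr x p : 0 <= x -> x^-1 `^ p = (x `^ p)^-1.
Proof. by move=> x0; rewrite -powR_inv1// -powRrM mulN1r powRN. Qed.

Lemma const_A_gt0 H : 0 < H < 1 -> 0 < const_A H.
Proof.
move=> /andP[H0 H1]; rewrite mulr_gt0 ?invr_gt0 ?subr_gt0//.
by rewrite powR_gt0// divr_gt0// subr_gt0.
Qed.

(** AM-GM with weights H and 1-H for y/H and u/(1-H), since [const_A H] is H^(-H) (1-H)^(-(1-H)). *)
Lemma const_A_le H u y : 0 < H < 1 -> 0 <= u -> 0 <= y ->
  const_A H * u `^ (1 - H) * y `^ H <= u + y.
Proof.
move=> H01; have /andP[H0 H1] := H01 => u0 y0.
have q0 : 0 < 1 - H by lra.
have := @weighted_amgm H (y / H) (u / (1 - H)) H01.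
have H0' := ltW H0; have q0' := ltW q0.
rewrite !divr_ge0// => /(_ isT isT).
rewrite [H * _]mulrC [(1 - H) * _]mulrC !divfK ?gt_eqF// [y + u]addrC.
apply: le_trans; rewrite !powRM ?invr_ge0//.
have -> : const_A H = H^-1 `^ H * (1 - H)^-1 `^ (1 - H).
  rewrite /const_A powRN powRM ?invr_ge0// !powR_invr// invf_div.
  have gE : 1 - H = (1 - H) `^ H * (1 - H) `^ (1 - H).
    by rewrite -gt0_powRD// subrKC powRr1.
  have iE : (1 - H)^-1 = ((1 - H) `^ H)^-1 * ((1 - H) `^ (1 - H))^-1.
    by rewrite -invfM -gE.
  rewrite [X in X * (_ / _)]iE.
  field; rewrite !gt_eqF// ?powR_gt0//.
rewrite le_eqVlt; apply/orP; left; apply/eqP; ring.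
Qed.

(** The equality case of [const_A_le], where y/H = u/(1-H). *)
Lemma const_A_eq H u : 0 < H < 1 -> 0 < u ->
  u + H / (1 - H) * u = const_A H * u `^ (1 - H) * (H / (1 - H) * u) `^ H.
Proof.
move=> /andP[H0 H1] u0; have q0 : 0 < 1 - H by lra.
have r0 : 0 < H / (1 - H) by rewrite divr_gt0.
rewrite powRM ?ltW// /const_A powRN.
transitivity ((1 - H)^-1 * (u `^ (1 - H) * u `^ H)).
  rewrite -gt0_powRD//.
  by rewrite subrK powRr1 ?ltW//; field; rewrite gt_eqF.
have : (H / (1 - H)) `^ H != 0 by rewrite gt_eqF// powR_gt0.
set z := _ `^ H => z0; field; rewrite z0 gt_eqF//.
Qed.

Lemma powR_dominated p q a M : 0 < p < q -> 0 < a -> 0 <= M ->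
  exists C : R, forall x, 0 <= x -> M * x `^ p <= a * x `^ q + C.
Proof.
(* At [x0] the two powers M x^p and a x^q meet; beyond it the second dominates, below it M x0^p
   bounds the first. *)
move=> /andP[p0 pq] a0 M0; pose x0 := (M / a) `^ (q - p)^-1.
exists (M * x0 `^ p) => x xge0.
have [xx0|x0x] := leP x x0.
  apply: (@le_trans _ _ (M * x0 `^ p)).
    by rewrite ler_wpM2l// ge0_ler_powR ?nnegrE ?powR_ge0// ltW.
  by rewrite lerDr mulr_ge0 ?powR_ge0// ltW.
have xgt0 : 0 < x by apply: le_lt_trans x0x; exact: powR_ge0.
apply: (@le_trans _ _ (a * x `^ q)); last by rewrite lerDl mulr_ge0 ?powR_ge0.
have -> : q = p + (q - p) by ring.
rewrite gt0_powRD//.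
rewrite mulrCA mulrC ler_wpM2l ?powR_ge0// -ler_pdivrMl// mulrC.
have -> : M / a = x0 `^ (q - p).
  by rewrite -powRrM mulVf ?gt_eqF ?subr_gt0// powRr1// divr_ge0// ltW.
by rewrite ge0_ler_powR ?nnegrE ?powR_ge0 ?subr_ge0// ltW.
Qed.

Lemma ln_le_powR p x : 0 < p -> 0 < x -> ln x <= p^-1 * x `^ p.
Proof.
move=> p0 x0; rewrite -ler_pdivrMl ?invr_gt0// invrK -ln_powR.
by apply/ltW/ln_sublinear; rewrite powR_gt0.
Qed.

Lemma ln_dominated q a M : 0 < q -> 0 < a -> 0 <= M ->
  exists C : R, forall x, 0 < x -> M * ln x <= a * x `^ q + C.
Proof.
move=> q0 a0 M0; have q2 : 0 < q / 2 by lra.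
have [||C hC] := @powR_dominated (q / 2) q a (M * (q / 2)^-1) _ a0.
- by lra.
- by rewrite mulr_ge0// invr_ge0 ltW.
exists C => x x0; apply: le_trans (hC _ (ltW x0)).
by rewrite -mulrA ler_wpM2l// ln_le_powR.
Qed.

Lemma expR_powR_decay q a (j : nat) : 0 < q -> 0 < a ->
  exists2 C : R, 0 < C & forall x, 0 < x -> expR (- (a * x `^ q)) <= C / x ^+ j.
Proof.
move=> q0 a0; have [||//|C hC] := @ln_dominated q a j%:R => //.
exists (expR C); first exact: expR_gt0.
move=> x x0; rewrite -[x ^+ j]lnK ?posrE ?exprn_gt0// -expRN -expRD ler_expR.
by rewrite lnXn// -mulr_natl; have := hC x x0; lra.
Qed.

(** A discrete integral comparison that makes the tails of the series of n^(-(1+p)) telescope. The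
    ratio of consecutive powers is exp(p ln((n+2)/(n+1))) >= 1 + p/(n+2). *)
Lemma powRN_telescope p (n : nat) : 0 < p ->
  p * (n.+2%:R : R) `^ (- (1 + p)) <= n.+1%:R `^ (- p) - n.+2%:R `^ (- p).
Proof.
move=> p0.
have n1 : (0 : R) < n.+1%:R by [].
have n2 : (0 : R) < n.+2%:R by [].
have -> : (n.+2%:R : R) `^ (- (1 + p)) = n.+2%:R `^ (- p) / n.+2%:R.
  by rewrite opprD gt0_powRD// powR_inv1 ?ler0n// mulrC.
have -> : (n.+1%:R : R) `^ (- p)
    = n.+2%:R `^ (- p) * expR (p * ln (n.+2%:R / n.+1%:R)).
  rewrite /powR !gt_eqF// -expRD; congr expR.
  by rewrite ln_div ?posrE//; ring.
have /(ler_wpM2l (ltW p0)) : (n.+2%:R : R)^-1 <= ln (n.+2%:R / n.+1%:R).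
  rewrite -[_ / _]invrK lnV ?posrE ?invr_gt0 ?divr_gt0// lerNr invf_div.
  have -> : (n.+1%:R : R) / n.+2%:R = 1 + - n.+2%:R^-1.
    have : (n.+2%:R : R) != 0 by rewrite pnatr_eq0.
    by rewrite -(natr1 n.+1) => n20; field.
  by apply: le_ln1Dx; rewrite ltrN2 invf_lt1// ltr1n.
have := expR_ge1Dx (p * ln ((n.+2%:R : R) / n.+1%:R)).
set e := expR _; set l := p * ln _ => h1 h2.
rewrite mulrCA -[X in _ <= _ - X]mulr1 -mulrBr ler_wpM2l ?powR_ge0//.
by apply: (le_trans h2); rewrite lerBrDl.
Qed.

End RealInequalities.

(** * The upper bound *)

Section Unions.
Context {d : measure_display} {T : measurableType d} {R : realType}.
Variable P : probability T R.

(** Countable subadditivity; writing the bounds as differences replaces the summation of a series by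
    f 0 - f n <= f 0. *)
Lemma prob_bigcup_telescope (F : nat -> set T) (f : nat -> R) :
  (forall k, measurable (F k)) -> (forall k, 0 <= f k) ->
  (forall k, (P (F k) <= (f k - f k.+1)%:E)%E) ->
  (P (\bigcup_k F k) <= (f 0)%:E)%E.
Proof.
move=> mF f0 PF.
apply: (@le_trans _ _ (\sum_(0 <= k <oo) P (F k))%E).
  by apply: measure_sigma_subadditive => //; exact: bigcupT_measurable.
apply: lime_le; first by apply: is_cvg_nneseries => *.
apply: nearW => n; apply: (@le_trans _ _ (\sum_(0 <= k < n) (f k - f k.+1)%:E)%E).
  by apply: lee_sum => k _.
rewrite sumEFin lee_fin.
rewrite (_ : \sum_(0 <= k < n) _ = - \sum_(0 <= k < n) (f k.+1 - f k)).
  by rewrite telescope_sumr// opprB gerBl.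
by rewrite -sumrN; apply: eq_bigr => k _; rewrite opprB.
Qed.

Lemma prob_bigcup_finite (n : nat) (F : nat -> set T) (c : R) : 0 <= c ->
  (forall k, (k < n)%N -> measurable (F k)) ->
  (forall k, (k < n)%N -> (P (F k) <= c%:E)%E) ->
  measurable (\bigcup_k (if (k < n)%N then F k else set0)) /\
  (P (\bigcup_k (if (k < n)%N then F k else set0)) <= (c *+ n)%:E)%E.
Proof.
move=> c0 mF PF.
have mG k : measurable (if (k < n)%N then F k else set0).
  by case: ifP => // kn; exact: mF.
split; first exact: bigcupT_measurable.
rewrite -[n in (c *+ n)%R]subn0.
(* Truncated subtraction makes this vanish from n on, where the sets are empty. *)
apply: (@prob_bigcup_telescope _ (fun k => c *+ (n - k))) => // k.
  by rewrite mulrn_wge0.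
case: ifP => [kn|/negbT]; last first.
  rewrite -leqNgt => nk; rewrite measure0 lee_fin subr_ge0.
  by rewrite (eqP nk) (eqP (leqW nk)).
by rewrite -(subnSK kn) mulrS addrK PF.
Qed.

End Unions.

(** A dyadic point of level m is reached from r by at most one step per level, and the geometric
    steps add up to x (1 - rho^(m+1)); continuity extends the bound to all s. *)
Lemma dyadic_chaining (R : realType) (f : R -> R) (r x rho : R) :
  continuous f -> 0 <= x -> 0 <= rho < 1 ->
  (forall m i, (i < 2 ^ m)%N ->
     `|f (r + i.+1%:R / 2 ^+ m) - f (r + i%:R / 2 ^+ m)|
       <= x * ((1 - rho) * rho ^+ m)) ->
  forall s, r <= s <= r + 1 -> `|f s - f r| <= x.
Proof.
move=> cf x0 /andP[rho0 rho1] incr.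
have dyadic m i : (i <= 2 ^ m)%N ->
    `|f (r + i%:R / 2 ^+ m) - f r| <= x * (1 - rho ^+ m.+1).
  have x_le (k : nat) : 0 <= x * (1 - rho ^+ k).
    by rewrite mulr_ge0// subr_ge0 exprn_ile1// ltW.
  elim: m i => [|m IHm] i; first case: i => [|[|//]] _.
  - by rewrite mul0r addr0 subrr normr0.
  - by have := incr 0%N 0%N isT; rewrite mul0r addr0 !expr0 mulr1 expr1.
  have halve j : (j.*2)%:R / 2 ^+ m.+1 = j%:R / 2 ^+ m :> R.
    rewrite exprS -muln2 natrM; field; exact: expf_neq0.
  (* An even index already belongs to level m; an odd one is a single step of level m+1 past an even
     one. *)
  rewrite -{1 2}(odd_double_half i) expnS mul2n.
  case: (odd i) => /=; last first.
    rewrite add0n leq_double halve => /IHm/le_trans; apply.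
    rewrite ler_wpM2l// lerD2l lerN2 [leLHS]exprS ler_piMl ?exprn_ge0//.
    exact: ltW.
  rewrite add1n ltn_double => jm.
  have := incr m.+1 (i./2).*2; rewrite expnS mul2n ltn_double => /(_ jm).
  have := IHm i./2 (ltnW jm); rewrite halve => h1 h2.
  rewrite -(subrKA (f (r + (i./2)%:R / 2 ^+ m))).
  apply: (le_trans (ler_normD _ _)); apply: le_trans (lerD h2 h1) _.
  by rewrite [rho ^+ m.+2]exprS; lra.
move=> s /andP[rs sr]; apply/ler_addgt0Pr => e e0.
have /cvgrPdist_lt/(_ e e0) := cf s.
move=> /nbhs_ballP[dl /= dl0 hdl].
(* A level fine enough that rounding s down to it moves s by less than [dl]. *)
pose m := (Num.truncn dl^-1).+1.
have m2 : 1 / 2 ^+ m < dl.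
  rewrite div1r invf_plt ?posrE ?exprn_gt0//.
  have /lt_le_trans : dl^-1 < m%:R by apply: truncnS_gt.
  by apply; rewrite -natrX ler_nat ltnW// ltn_expl.
pose y := (s - r) * 2 ^+ m.
have y0 : 0 <= y by rewrite mulr_ge0 ?subr_ge0// exprn_ge0.
pose i := Num.truncn y.
have /andP[iy yi] : i%:R <= y < i.+1%:R by apply: truncn_itv.
have p2 : (0 : R) < 2 ^+ m by rewrite exprn_gt0.
have im : (i <= 2 ^ m)%N.
  rewrite -(ler_nat R) natrX; apply: le_trans iy _.
  by rewrite /y ler_piMl ?(ltW p2)//; lra.
have sE : s = r + y / 2 ^+ m by rewrite /y mulfK ?gt_eqF//; ring.
have sb : `|s - (r + i%:R / 2 ^+ m)| < dl.
  apply: le_lt_trans m2.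
  have -> : s - (r + i%:R / 2 ^+ m) = (y - i%:R) / 2 ^+ m by rewrite {1}sE; ring.
  rewrite ger0_norm; last by rewrite divr_ge0 ?subr_ge0// ltW.
  rewrite ler_pM2r ?invr_gt0//.
  by move: yi; rewrite -natr1; lra.
have h1 := hdl (r + i%:R / 2 ^+ m) sb.
have h2 := dyadic m i im.
rewrite -(subrKA (f (r + i%:R / 2 ^+ m))).
apply: (le_trans (ler_normD _ _)).
rewrite [x + e]addrC; apply: lerD; first exact: ltW.
apply: le_trans h2 _; rewrite ler_piMr// gerBl exprn_ge0//.
Qed.

Section Oscillation.
Context {d : measure_display} {T : measurableType d} {R : realType}.
Context {P : probability T R} {H : R} {B : R -> {RV P >-> R}}.
Hypothesis H_gt0 : 0 < H.
Hypothesis fbmB : fractional_brownian_motion H B.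

Local Notation h := (fbm_kernel H).

Lemma fbm_oscillation : exists K th : R, [/\ 0 < K, 0 < th &
  forall r x : R, 1 <= x -> exists E : set T, [/\ measurable E,
    (P E <= (K * expR (- (th * x ^+ 2)))%:E)%E &
    forall w, ~ E w -> forall s, r <= s <= r + 1 -> `|B s w - B r w| <= x]].
Proof.
pose rho : R := 2 `^ (- (H / 2)).
have rho0 : 0 < rho by rewrite powR_gt0.
have rho1 : rho < 1.
  have ln2 : 0 < ln (2 : R) by rewrite ln_gt0// ltr1n.
  by rewrite /rho /powR pnatr_eq0 /= -[ltRHS]expR0 ltr_expR mulNr oppr_lt0 mulr_gt0 ?divr_gt0.
pose th : R := (1 - rho) ^+ 2 / 2.
have th0 : 0 < th by rewrite divr_gt0// exprn_gt0// subr_gt0.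
have [C C0 hC] := @expR_powR_decay R H (th / 2) 2 H_gt0 (divr_gt0 th0 (ltr0Sn R 1)).
exists (4 * C), (th / 2); split; [by rewrite mulr_gt0|by rewrite divr_gt0|].
move=> r x x1.
pose y m : R := x * ((1 - rho) * rho ^+ m).
pose p m i : R := r + i%:R / 2 ^+ m.
pose D m i : set T := [set w | y m < B (p m i.+1) w - B (p m i) w] `|`
  [set w | y m < B (p m i) w - B (p m i.+1) w].
pose e := expR (- (th / 2 * x ^+ 2)).
pose F m := \bigcup_i (if (i < 2 ^ m)%N then D m i else set0).
have x0 : 0 <= x by lra.
have y0 m : 0 <= y m.
  by rewrite !mulr_ge0// ?exprn_ge0 ?ltW// subr_gt0.
have mD m i : measurable (D m i).
  by apply: measurableU; exact: fbm_measurable_gt.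
have p_gt0 m : (0 : R) < 2 ^+ m by rewrite exprn_gt0.
have hp m i : h (p m i.+1 - p m i) = rho ^+ (4 * m).
  have -> : p m i.+1 - p m i = (2 ^+ m)^-1.
    by rewrite /p -natr1; field; rewrite gt_eqF.
  rewrite /fbm_kernel ger0_norm ?invr_ge0 ?ltW// /rho.
  rewrite powR_invr ?ltW// -powRN -powR_mulrn// -powRrM.
  rewrite -powR_mulrn ?powR_ge0// -powRrM natrM.
  by congr (_ `^ _); field.
have PD m i : (P (D m i) <= (2 * (e * (C / (2 ^+ m) ^+ 2)))%:E)%E.
  have pne : p m i.+1 != p m i.
    rewrite /p (inj_eq (addrI r)) -subr_eq0 -mulrBl -natr1 [_ + 1]addrC addrK.
    by rewrite mul1r gt_eqF// invr_gt0.
  have e_le : expR (- (y m ^+ 2 / (2 * rho ^+ (4 * m)))) <= e * (C / (2 ^+ m) ^+ 2).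
    have -> : y m ^+ 2 / (2 * rho ^+ (4 * m)) = th * x ^+ 2 * (2 ^+ m) `^ H.
      have -> : (2 ^+ m) `^ H = (rho ^+ (2 * m))^-1.
        rewrite -powR_mulrn// -powRrM -powR_mulrn ?powR_ge0// -powRrM -powRN.
        by rewrite natrM; congr (_ `^ _); field.
      rewrite /y /th !exprM !exprMn; field.
      by rewrite expf_neq0// gt_eqF.
    set z := _ `^ H.
    have z1 : 1 <= z.
      by rewrite -(powRr0 (2 ^+ m)) ler_powR ?(ltW H_gt0)// exprn_ege1// ler1n.
    (* As x^2 and z are at least 1, x^2 z >= (x^2 + z)/2: one half gives the tail in x, the other
       pays for the sum over levels. *)
    apply: (@le_trans _ _ (e * expR (- (th / 2 * z)))).
      rewrite -expRD ler_expR.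
      have x2 : 1 <= x ^+ 2 by rewrite exprn_ege1.
      have : 0 <= th * (x ^+ 2 * (z - 1) + z * (x ^+ 2 - 1)).
        rewrite mulr_ge0 ?(ltW th0)// addr_ge0// mulr_ge0//; lra.
      lra.
    by rewrite ler_wpM2l ?expR_ge0// hC.
  apply: le_trans (measureU2 _ _ _) _; try exact: fbm_measurable_gt.
  rewrite mulrDl mul1r EFinD; apply: leeD.
    apply: le_trans (fbm_tail H_gt0 fbmB pne (y0 m)) _.
    by rewrite hp lee_fin.
  rewrite eq_sym in pne.
  apply: le_trans (fbm_tail H_gt0 fbmB pne (y0 m)) _.
  by rewrite fbm_kernelC hp lee_fin.
have F_ok m : measurable (F m) /\ (P (F m) <= (2 * (e * (C / (2 ^+ m) ^+ 2)) *+ 2 ^ m)%:E)%E.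
  apply: prob_bigcup_finite => [|i _|i _]; [|exact: mD|exact: PD].
  by rewrite !mulr_ge0 ?invr_ge0 ?expR_ge0 ?exprn_ge0// ltW.
exists (\bigcup_m F m); split.
- by apply: bigcupT_measurable => m; case: (F_ok m).
- have -> : 4 * C * expR (- (th / 2 * x ^+ 2)) = 4 * C * e / 2 ^+ 0 by rewrite expr0 divr1.
  apply: (@prob_bigcup_telescope _ _ _ P F (fun m => 4 * C * e / 2 ^+ m)) => m.
  + by case: (F_ok m).
  + by rewrite !mulr_ge0 ?invr_ge0 ?expR_ge0 ?exprn_ge0// ltW.
  + case: (F_ok m) => _ /le_trans; apply; rewrite lee_fin.
    rewrite -mulr_natr natrX le_eqVlt; apply/orP; left; apply/eqP.
    by rewrite [2 ^+ m.+1]exprS; field; rewrite gt_eqF.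
- move=> w wE; apply: (@dyadic_chaining R (fun s => B s w) r x rho) => //.
  + by have [_ _ _ cB] := fbmB; exact: cB.
  + by rewrite ltW.
  + move=> m i im; rewrite leNgt; apply/negP => lt_y; apply: wE.
    exists m => //; exists i => //; rewrite im /D /=.
    move: lt_y; rewrite ltr_normr => /orP[|]; first by left.
    by rewrite opprB; right.
Qed.

End Oscillation.

Section StorageTail.
Context {d : measure_display} {T : measurableType d} {R : realType}.
Context {P : probability T R} {H : R} {B : R -> {RV P >-> R}}.
Hypothesis H_gt0 : 0 < H.
Hypothesis H_lt1 : H < 1.
Hypothesis fbmB : fractional_brownian_motion H B.

Local Notation h := (fbm_kernel H).

(** A share 1-e of (u + y)^2 is bounded below by [const_A_le] and gives the main exponent; the share
    e is bounded below by e y^2 and gives decay in the lag. The factor 1-e in the threshold leaves e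
    (u + y) for oscillations. *)
Lemma fbm_drift_tail (e : R) : 0 < e < 1 -> exists2 C : R, 0 < C &
  forall u r y : R, 0 < u -> 0 < y ->
    (P [set w | ((1 - e) * (u + y) < B r w - B (r - y) w)%R]
     <= (expR (- ((1 - e) ^+ 3 * const_A H ^+ 2 / 2 * u `^ (2 * (1 - H))))
         * (C / y ^+ 2))%:E)%E.
Proof.
move=> /andP[e0 e1]; pose a : R := (1 - e) ^+ 2 * e / 2.
have a0 : 0 < a by rewrite divr_gt0// mulr_gt0// exprn_gt0// subr_gt0.
have k0 : 0 < 2 * (1 - H) by rewrite mulr_gt0// subr_gt0.
have [C C0 hC] := @expR_powR_decay R _ a 2 k0 a0.
exists C => // u r y u0 y0.
have ry : r != r - y by rewrite -subr_eq0 opprB addrC subrK gt_eqF.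
have x0 : 0 <= (1 - e) * (u + y) by rewrite mulr_ge0//; lra.
apply: le_trans (fbm_tail H_gt0 fbmB ry x0) _; rewrite lee_fin.
apply: (@le_trans _ _ (expR (- ((1 - e) ^+ 3 * const_A H ^+ 2 / 2
   * u `^ (2 * (1 - H)))) * expR (- (a * y `^ (2 * (1 - H)))))); last first.
  by rewrite ler_wpM2l ?expR_ge0// hC.
rewrite -expRD ler_expR -opprD lerN2.
have -> : h (r - (r - y)) = y `^ (2 * H).
  by rewrite /fbm_kernel opprB addrC subrK gtr0_norm.
set Y := y `^ (2 * H); have Y0 : 0 < Y by rewrite powR_gt0.
rewrite ler_pdivlMr ?mulr_gt0//.
have h1 : const_A H ^+ 2 * u `^ (2 * (1 - H)) * Y <= (u + y) ^+ 2.
  have H01 : 0 < H < 1 by rewrite H_gt0.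
  have A0 := const_A_gt0 H01.
  have -> : const_A H ^+ 2 * u `^ (2 * (1 - H)) * Y
     = (const_A H * u `^ (1 - H) * y `^ H) ^+ 2.
    rewrite !exprMn /Y ![2 * _]mulrC !powRrM.
    by rewrite !powR_mulrn ?powR_ge0.
  apply: lerXn2r; rewrite ?nnegrE.
  - by rewrite mulr_ge0 ?powR_ge0// mulr_ge0 ?powR_ge0// (ltW A0).
  - by rewrite addr_ge0// ltW.
  - by apply: const_A_le => //; exact: ltW.
have h2 : y `^ (2 * (1 - H)) * Y <= (u + y) ^+ 2.
  rewrite -gt0_powRD//; have -> : 2 * (1 - H) + 2 * H = 2%:R by ring.
  rewrite powR_mulrn ?(ltW y0)//; apply: lerXn2r; rewrite ?nnegrE//; lra.
rewrite [((1 - e) * _) ^+ 2]exprMn.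
have -> : ((1 - e) ^+ 3 * const_A H ^+ 2 / 2 * u `^ (2 * (1 - H))
    + a * y `^ (2 * (1 - H))) * (2 * Y)
  = (1 - e) ^+ 2 * ((1 - e) * (const_A H ^+ 2 * u `^ (2 * (1 - H)) * Y)
     + e * (y `^ (2 * (1 - H)) * Y)) by rewrite /a; field.
rewrite ler_wpM2l ?sqr_ge0//.
have -> : (u + y) ^+ 2 = (1 - e) * (u + y) ^+ 2 + e * (u + y) ^+ 2 by ring.
by rewrite lerD// ler_wpM2l//; lra.
Qed.

(** Every s <= t lies in [r, r+1] or in some interval [r-j, r-j+1]. The drift tail handles the
    integer lag j, two oscillations of size about e (u + j) / 4 handle t and s, and 5/e <= u absorbs
    the rounding errors. *)
Lemma storage_tail (e : R) : 0 < e < 1 -> exists2 K : R, 0 < K &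
  forall u r : R, 5 / e <= u -> exists E : set T, [/\ measurable E,
    (P E <= (K * expR (- ((1 - e) ^+ 3 * const_A H ^+ 2 / 2
              * u `^ (2 * (1 - H)))))%:E)%E &
    forall w, ~ E w -> forall t s, r <= t <= r + 1 -> s <= t ->
      B t w - B s w - (t - s) <= u].
Proof.
move=> e01; have /andP[e0 e1] := e01.
have H01 : 0 < H < 1 by rewrite H_gt0.
have A0 := const_A_gt0 H01.
have [C1 C10 drift] := fbm_drift_tail e01.
have [K [th [K0 th0 osc]]] := fbm_oscillation H_gt0 fbmB.
pose b : R := th * (e / 4) ^+ 2.
have b0 : 0 < b by rewrite mulr_gt0// exprn_gt0// divr_gt0.
pose c : R := (1 - e) ^+ 3 * const_A H ^+ 2 / 2.
have c0 : 0 <= c.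
  by rewrite divr_ge0// mulr_ge0 ?sqr_ge0// exprn_ge0//; lra.
(* Since 2(1-H) < 2, the Gaussian exponent b u^2 of the oscillations exceeds the main one up to a
   constant. *)
have [|C2 hC2] := @powR_dominated R (2 * (1 - H)) 2 b c _ b0 c0.
  by have := H_gt0; have := H_lt1; lra.
have [C3 C30 hC3] := @expR_powR_decay R 2 b 2 (ltr0Sn R 1) b0.
pose M : R := C1 + K * expR C2 * C3.
have M0 : 0 < M by rewrite addr_gt0// !mulr_gt0// expR_gt0.
exists (2 * M) => [|u r ue]; first by rewrite mulr_gt0.
have u0 : 0 < u by apply: lt_le_trans ue; rewrite divr_gt0.
have eu : 5 <= e * u by rewrite mulrC -ler_pdivrMr.
pose y (j : nat) : R := j.+1%:R.
have y0 j : 0 < y j by [].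
pose x j : R := e / 4 * (u + y j).
have x1 j : 1 <= x j.
  have := mulr_ge0 (ltW e0) (ltW (y0 j)); rewrite /x; lra.
pose G j := projT1 (cid (osc (r - j%:R) (x j) (x1 j))).
have GP j := projT2 (cid (osc (r - j%:R) (x j) (x1 j))).
pose F j := [set w | ((1 - e) * (u + y j) < B r w - B (r - y j) w)%R].
pose X := expR (- (c * u `^ (2 * (1 - H)))).
exists (\bigcup_j (F j `|` G j)); split.
- apply: bigcupT_measurable => j; apply: measurableU.
    exact: fbm_measurable_gt.
  by case: (GP j).
- rewrite -[X in (_ <= X%:E)%E]divr1.
  (* For y = j+1 >= 1 one has 1/y^2 <= 2/(y(y+1)) = 2/y - 2/(y+1). *)
  apply: (@prob_bigcup_telescope _ _ _ P _ (fun j => 2 * M * X / j.+1%:R)) => j.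
  + apply: measurableU; first exact: fbm_measurable_gt.
    by case: (GP j).
  + by rewrite !mulr_ge0 ?expR_ge0// ltW.
  + case: (GP j) => mG PG _.
    apply: le_trans (measureU2 _ _ mG) _; first exact: fbm_measurable_gt.
    apply: (@le_trans _ _ (X * (C1 / y j ^+ 2) + X * (K * expR C2 * (C3 / y j ^+ 2)))%:E).
      rewrite EFinD; apply: leeD; first exact: drift.
      apply: (le_trans PG); rewrite lee_fin.
      have -> : X * (K * expR C2 * (C3 / y j ^+ 2))
        = K * (expR C2 * X * (C3 / y j ^+ 2)) by ring.
      rewrite ler_wpM2l ?(ltW K0)// -expRD.
      apply: (@le_trans _ _ (expR (C2 - c * u `^ (2 * (1 - H))) * expR (- (b * y j `^ 2)))).
        rewrite -expRD ler_expR.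
        have := hC2 u (ltW u0); rewrite !powR_mulrn ?(ltW u0) ?(ltW (y0 j))//.
        have := mulr_ge0 (ltW b0) (mulr_ge0 (ltW u0) (ltW (y0 j))).
        have -> : th * x j ^+ 2 = b * (u + y j) ^+ 2 by rewrite /b /x; ring.
        lra.
      by rewrite ler_wpM2l ?expR_ge0// hC3.
    rewrite lee_fin.
    have -> : X * (C1 / y j ^+ 2) + X * (K * expR C2 * (C3 / y j ^+ 2))
      = X * M / y j ^+ 2 by rewrite /M; ring.
    have -> : 2 * M * X / j.+1%:R - 2 * M * X / j.+2%:R
       = X * M * (2 / (y j * (y j + 1))).
      rewrite -(natr1 j.+1) -/(y j); have := y0 j; move: (y j) => z z0.
      by field; rewrite !gt_eqF// addr_gt0.
    rewrite ler_wpM2l ?mulr_ge0 ?expR_ge0 ?(ltW M0)//.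
    rewrite ler_pdivlMr ?mulr_gt0 ?addr_gt0// mulrC ler_pdivrMr ?exprn_gt0//.
    have : 1 <= y j by rewrite ler1n.
    by have := y0 j; nra.
- move=> w wE t s /andP[rt tr] st.
  have wF j : B r w - B (r - y j) w <= (1 - e) * (u + y j).
    by rewrite leNgt; apply/negP => Fj; apply: wE; exists j => //; left.
  have wG j s' : r - j%:R <= s' <= r - j%:R + 1 ->
      `|B s' w - B (r - j%:R) w| <= x j.
    have [_ _ wGj] := GP j; apply: wGj => Gj; apply: wE; exists j => //; right.
    exact: Gj.
  have [j /andP[js sj] wj] : exists2 j : nat, r - j%:R <= s <= r - j%:R + 1 &
      B r w - B (r - j%:R) w <= (1 - e) * (u + j%:R).
    have [rs|sr] := leP r s.
      exists 0%N; first by rewrite subr0 rs (le_trans st).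
      by rewrite subr0 subrr addr0 mulr_ge0 ?subr_ge0 ?(ltW e1)// ltW.
    have rs0 : 0 <= r - s by rewrite subr_ge0 ltW.
    (* The lag r - s is rounded up, so that s lies in the unit interval starting at r - j. *)
    exists (Num.truncn (r - s)).+1; last exact: wF.
    have /andP[t1 t2] := truncn_itv rs0.
    by apply/andP; split; [lra|rewrite -natr1; lra].
  have := wG j s; rewrite js sj => /(_ isT); rewrite ler_norml => /andP[hs _].
  have := wG 0%N t; rewrite subr0 rt tr => /(_ isT); rewrite ler_norml => /andP[_ ht].
  have ej : 0 <= e * j%:R by rewrite mulr_ge0// ltW.
  move: hs ht wj eu ej js; rewrite /x /y -(natr1 j).
  move: e0 e1 sj rt tr st u0; lra.
Qed.

End StorageTail.

Lemma powRN_archimedean (R : realType) (p K v : R) : 0 < p -> 0 < v ->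
  exists N : nat, K * N.+1%:R `^ (- p) < v.
Proof.
move=> p0 v0; pose x : R := (`|K| / v) `^ p^-1.
exists (Num.truncn x); have xN := truncnS_gt x.
set n : R := _%:R in xN *.
have n0 : 0 < n by [].
rewrite powRN ltr_pdivrMr ?powR_gt0//.
apply: le_lt_trans (ler_norm K) _; rewrite mulrC -ltr_pdivrMr//.
have -> : `|K| / v = x `^ p.
  by rewrite -powRrM mulVf ?gt_eqF// powRr1// divr_ge0// ltW.
by rewrite gt0_ltr_powR// nnegrE ?powR_ge0// ltW.
Qed.

Section StorageUpper.
Context {d : measure_display} {T : measurableType d} {R : realType}.
Context {P : probability T R} {H : R} {B : R -> {RV P >-> R}}.
Hypothesis H_gt0 : 0 < H.
Hypothesis H_lt1 : H < 1.
Hypothesis fbmB : fractional_brownian_motion H B.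

Local Notation beta := (2 * (1 - H))^-1.

(** Borel-Cantelli: on [n, n+1] the level (g ln n)^(1/(2(1-H))) is exceeded with probability at most
    K n^(-q), with q = (1-e)^3 [const_A H]^2 g / 2 > 1 for small e. *)
Lemma storage_upper (g : R) : 2 / const_A H ^+ 2 < g ->
  P.-negligible [set w | ~ exists t0 : R, forall t, t0 <= t ->
    (storage B t w <= ((g * ln t) `^ beta)%:E)%E].
Proof.
have H01 : 0 < H < 1 by rewrite H_gt0.
have A0 := const_A_gt0 H01; have A20 : 0 < const_A H ^+ 2 by rewrite exprn_gt0.
have k0 : 0 < 2 * (1 - H) by rewrite mulr_gt0// subr_gt0.
have b0 : 0 < beta by rewrite invr_gt0.
rewrite ltr_pdivrMr// => Ag.
pose c : R := const_A H ^+ 2 * g / 2.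
have c1 : 1 < c by rewrite /c [_ * g]mulrC; lra.
have c0 : 0 < c by lra.
have g0 : 0 < g by rewrite -(pmulr_lgt0 _ A20); lra.
(* Then (1-e)^3 c >= (1-3e) c = 1 + (c-1)/4 > 1. *)
pose e : R := (c - 1) / (4 * c).
have ec : e * (4 * c) = c - 1 by rewrite /e divfK// mulf_neq0// gt_eqF.
have e0 : 0 < e by rewrite divr_gt0//; lra.
have e1 : e < 1 by nra.
have e01 : 0 < e < 1 by rewrite e0.
pose q : R := (1 - e) ^+ 3 * c.
have q1 : 1 < q.
  have : (1 - 3 * e) * c <= (1 - e) ^+ 3 * c.
    rewrite ler_pM2r// -subr_ge0.
    have -> : (1 - e) ^+ 3 - (1 - 3 * e) = e ^+ 2 * (3 - e) by ring.
    by rewrite mulr_ge0 ?sqr_ge0//; lra.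
  rewrite -/q; lra.
have [K K0 tail] := storage_tail H_gt0 H_lt1 fbmB e01.
pose u (x : R) : R := (g * ln x) `^ beta.
have u_mono x y : 1 <= x -> x <= y -> u x <= u y.
  move=> x1 xy; apply: ge0_ler_powR; rewrite ?nnegrE ?(ltW b0)//.
  - by rewrite mulr_ge0 ?(ltW g0)// ln_ge0.
  - by rewrite mulr_ge0 ?(ltW g0)// ln_ge0// (le_trans x1).
  - by rewrite ler_pM2l// ler_ln ?posrE//; lra.
(* The point where the level [u] reaches 5/e, the least one allowed in [storage_tail]. *)
pose x0 : R := expR ((5 / e) `^ (2 * (1 - H)) / g).
have x01 : 1 <= x0.
  by rewrite -expR0 ler_expR divr_ge0 ?powR_ge0// ltW.
have u0 x : x0 <= x -> 5 / e <= u x.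
  move=> xx; apply: le_trans (u_mono _ _ x01 xx).
  rewrite /u /x0 expRK mulrCA mulfV ?gt_eqF// mulr1 -powRrM mulfV ?gt_eqF// powRr1//.
  by rewrite divr_ge0// ltW.
pose N0 := (Num.truncn x0).+1.
have N0x n : x0 <= (N0 + n)%:R.
  by rewrite natrD; apply: (le_trans (ltW (truncnS_gt _))); rewrite lerDl.
have /choice[E hE] := fun n => tail (u (N0 + n)%:R) (N0 + n)%:R (u0 _ (N0x n)).
have PE n : (P (E n) <= (K * (N0 + n)%:R `^ (- q))%:E)%E.
  have [_ + _] := hE n; move=> /le_trans; apply.
  rewrite lee_fin ler_wpM2l ?(ltW K0)//.
  have n0 : (0 : R) < (N0 + n)%:R by rewrite ltr0n.
  rewrite [leRHS]/powR gt_eqF// ler_expR mulNr lerN2.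
  rewrite -powRrM mulVf ?gt_eqF// powRr1; last first.
    by rewrite mulr_ge0 ?(ltW g0)// ln_ge0// (le_trans x01).
  by rewrite le_eqVlt; apply/orP; left; apply/eqP; rewrite /q /c; field.
pose p := q - 1; have p0 : 0 < p by rewrite subr_gt0.
pose F N := \bigcup_n E (N + n).+1.
have PF N : (P (F N) <= (K / p * N.+1%:R `^ (- p))%:E)%E.
  pose f n : R := K / p * (N0.-1 + N + n).+1%:R `^ (- p).
  apply: (@le_trans _ _ (f 0%N)%:E).
    apply: prob_bigcup_telescope => n.
    - by case: (hE (N + n).+1).
    - by rewrite mulr_ge0 ?powR_ge0// divr_ge0// ltW.
    apply: le_trans (PE _) _; rewrite lee_fin.
    rewrite /f -mulrBr.
    have -> : (N0 + (N + n).+1 = (N0.-1 + N + n).+2)%N by rewrite /N0 /= addnS addSn addnA.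
    rewrite [(N0.-1 + N + n.+1)%N]addnS.
    have -> : q = 1 + p by rewrite /p; ring.
    rewrite -mulrA ler_pM2l// mulrC -ler_pdivrMr ?invr_gt0// invrK mulrC.
    exact: powRN_telescope.
  rewrite /f addn0 lee_fin ler_wpM2l ?divr_ge0 ?(ltW K0) ?(ltW p0)//.
  rewrite !powRN lef_pV2 ?posrE ?powR_gt0//.
  by rewrite ge0_ler_powR ?nnegrE ?(ltW p0)// ler_nat ltnS leq_addl.
have mF N : measurable (F N).
  by apply: bigcupT_measurable => n; case: (hE (N + n).+1).
pose S := \bigcap_N F N.
have mS : measurable S by apply: bigcapT_measurable.
have PS : P S = 0%E.
  rewrite -(@fineK _ (P S)) ?fin_num_measure//; congr (_%:E); apply/eqP.
  rewrite eq_le fine_ge0// andbT leNgt; apply/negP => v0.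
  have [N] := powRN_archimedean (K / p) p0 v0.
  rewrite ltNge => /negP; apply.
  rewrite -lee_fin fineK ?fin_num_measure//.
  apply: le_trans (PF N); apply: le_measure; rewrite ?inE//.
  exact: bigcap_inf.
apply: (@negligibleS _ _ _ _ S); last exact/negligibleP.
move=> w wB N _; apply: contrapT => wF; apply: wB.
exists (N0 + N.+1)%:R => t tN.
have t0 : 0 <= t by apply: le_trans tN.
(* The event for [m, m+1] bounds the storage at t by [u m], and [u] is increasing. *)
pose m := Num.truncn t.
have /andP[mt tm] := truncn_itv t0.
have Nm : (N0 + N.+1 <= m)%N.
  by rewrite /m -[X in (X <= _)%N](@natrK R) le_truncn.
pose n := (m - (N0 + N.+1))%N.
have mE : m = (N0 + (N + n).+1)%N.
  by rewrite -addSn addnA subnKC.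
have [_ _ hw] := hE (N + n).+1.
rewrite -mE in hw.
apply: (@le_trans _ _ (u m%:R)%:E).
  apply: ge_ereal_sup => _ [s /= st <-]; rewrite lee_fin.
  apply: hw => //; first by move=> Ew; apply: wF; exists n.
  by rewrite mt /= natr1 ltW.
rewrite lee_fin; apply: u_mono => //.
by rewrite mE ler1n addnS.
Qed.

End StorageUpper.

(** * The lower bound *)

Section SecondMoment.
Context {d : measure_display} {T : measurableType d} {R : realType}.
Variable P : probability T R.

(** Tilting by l moves a standard normal mean to l. The two subtracted exponentials are Chernoff
    factors: Y exp(e l (x - (1+e) l)) dominates Y above the window and Y exp(-e l (x - (1-e) l))
    below it. *)
Lemma tilted_truncation (l e x : R) : 0 < l -> 0 < e ->
  let Y := expR (l * x - l ^+ 2 / 2) in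
  let w := if (1 - e) * l < x <= (1 + e) * l then Y else 0 in
  [/\ 0 <= w, w <= Y, w <= expR ((1 / 2 + e) * l ^+ 2) &
    Y - expR ((1 + e) * l * x - l ^+ 2 / 2 - e * (1 + e) * l ^+ 2)
      - expR ((1 - e) * l * x - l ^+ 2 / 2 + e * (1 - e) * l ^+ 2) <= w].
Proof.
move=> l0 e0 Y w; have Y0 : 0 < Y by apply: expR_gt0.
rewrite /w; case: ifP => [/andP[_ xle]|/negbT].
  split => //; first exact: ltW.
    rewrite ler_expR; have := ler_wpM2l (ltW l0) xle; lra.
  by rewrite -addrA -opprD gerBl addr_ge0// expR_ge0.
rewrite negb_and -leNgt -ltNge => xout; split; [by []|exact: ltW|exact: expR_ge0|].
rewrite -addrA -opprD subr_le0; case/orP: xout => xout.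
  apply: (@le_trans _ _ (expR ((1 - e) * l * x - l ^+ 2 / 2 + e * (1 - e) * l ^+ 2))).
    rewrite ler_expR; have := ler_wpM2l (ltW (mulr_gt0 e0 l0)) xout; lra.
  by rewrite lerDr expR_ge0.
apply: (@le_trans _ _ (expR ((1 + e) * l * x - l ^+ 2 / 2 - e * (1 + e) * l ^+ 2))).
  rewrite ler_expR; have := ler_wpM2l (ltW (mulr_gt0 e0 l0)) (ltW xout); lra.
by rewrite lerDl expR_ge0.
Qed.

(* [Z] majorizes (W-1)^2 pointwise, with W the truncated tilted average; being a
   combination of exponentials of pairs of variables, it has a known mean.  The
   truncation is used only on the diagonal, where it makes E W^2 small for l^2 up
   to 2 log n instead of log n. *)
Lemma prob_all_small (n : nat) (X : 'I_n -> T -> R) (l e r : R) (A : set T) :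
  (0 < n)%N -> 0 < l -> 0 < e ->
  (forall i a, has_expectation P (fun w => expR (a * X i w)) (expR (a ^+ 2 / 2))) ->
  (forall i j, i != j -> exists2 b, b <= l ^+ 2 + r &
     has_expectation P (fun w => expR (l * X i w + l * X j w)) (expR b)) ->
  measurable A -> (forall w, A w -> forall i, X i w <= (1 - e) * l) ->
  (P A <= (expR r - 1 + expR ((1 / 2 + e) * l ^+ 2) / n%:R
           + 4 * expR (- (e ^+ 2 * l ^+ 2 / 2)))%:E)%E.
Proof.
move=> n0 l0 e0 EX EXX mA AX.
pose D := expR ((1 / 2 + e) * l ^+ 2).
pose Y i w := expR (l * X i w - l ^+ 2 / 2).
pose L i w := Y i w - expR ((1 + e) * l * X i w - l ^+ 2 / 2 - e * (1 + e) * l ^+ 2)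
      - expR ((1 - e) * l * X i w - l ^+ 2 / 2 + e * (1 - e) * l ^+ 2).
pose v i w := if (1 - e) * l < X i w <= (1 + e) * l then Y i w else 0.
pose c i j w := if i == j then D * Y i w else Y i w * Y j w.
(* In (W-1)^2 = 1 - 2 W + W^2 the linear term uses the lower bound [L], the quadratic one the upper
   bound [c]. *)
pose Z w := 1 + - (2 / n%:R) * (\sum_(i < n) L i w)
  + (n%:R ^+ 2)^-1 * (\sum_(i < n) \sum_(j < n) c i j w).
have vP i w := tilted_truncation (X i w) l0 e0.
have nR : (0 : R) < n%:R by rewrite ltr0n.
have shift i a b : has_expectation P (fun w => expR (a * X i w + b))
    (expR (a ^+ 2 / 2 + b)).
  under eq_fun do rewrite expRD mulrC; rewrite expRD mulrC.
  exact: has_expectationZ.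
have EY i : has_expectation P (Y i) 1.
  by have := shift i l (- (l ^+ 2 / 2)); rewrite subrr expR0.
pose dl := expR (- (e ^+ 2 * l ^+ 2 / 2)).
have EL i : has_expectation P (L i) (1 - 2 * dl).
  have := has_expectationD (has_expectationD (EY i)
    (has_expectationZ (-1) (shift i ((1 + e) * l) (- (l ^+ 2 / 2) - e * (1 + e) * l ^+ 2))))
    (has_expectationZ (-1) (shift i ((1 - e) * l) (- (l ^+ 2 / 2) + e * (1 - e) * l ^+ 2))).
  have -> : ((1 + e) * l) ^+ 2 / 2 + (- (l ^+ 2 / 2) - e * (1 + e) * l ^+ 2)
    = - (e ^+ 2 * l ^+ 2 / 2) by field.
  have -> : ((1 - e) * l) ^+ 2 / 2 + (- (l ^+ 2 / 2) + e * (1 - e) * l ^+ 2)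
    = - (e ^+ 2 * l ^+ 2 / 2) by field.
  have -> : 1 + -1 * expR (- (e ^+ 2 * l ^+ 2 / 2)) + -1 * expR (- (e ^+ 2 * l ^+ 2 / 2))
    = 1 - 2 * dl by rewrite /dl; ring.
  by congr (has_expectation P _ _); apply/funext => w; rewrite !mulN1r !addrA.
have Ec i j : exists2 b, b <= (if i == j then D else 0) + expR r &
    has_expectation P (c i j) b.
  rewrite /c; have [_|ij] := eqVneq i j.
    exists D; first by rewrite lerDl expR_ge0.
    by have := has_expectationZ D (EY i); rewrite mulr1.
  have [b br Eb] := EXX i j ij.
  exists (expR (- l ^+ 2) * expR b); first by rewrite add0r -expRD ler_expR; lra.
  have := has_expectationZ (expR (- l ^+ 2)) Eb.
  congr (has_expectation P _ _); apply/funext => w.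
  by rewrite /Y -!expRD; congr expR; field.
pose bb i j := s2val (cid2 (Ec i j)).
have bbE i j : has_expectation P (c i j) (bb i j) := s2valP' (cid2 (Ec i j)).
have bb_le i j : bb i j <= (if i == j then D else 0) + expR r
  := s2valP (cid2 (Ec i j)).
have EZ := has_expectationD (has_expectationD (has_expectation_cst P 1)
  (has_expectationZ (- (2 / n%:R)) (has_expectation_sum (index_enum 'I_n) EL)))
  (has_expectationZ (n%:R ^+ 2)^-1
    (has_expectation_sum (index_enum 'I_n)
       (fun i => has_expectation_sum (index_enum 'I_n) (bbE i)))).
have ZW w : (n%:R^-1 * (\sum_(i < n) v i w) - 1) ^+ 2 <= Z w.
  have sL : \sum_(i < n) L i w <= \sum_(i < n) v i w.
    by apply: ler_sum => i _; case: (vP i w).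
  have sc : (\sum_(i < n) v i w) ^+ 2 <= \sum_(i < n) \sum_(j < n) c i j w.
    rewrite expr2 big_distrl /=; apply: ler_sum => i _.
    rewrite big_distrr /=; apply: ler_sum => j _; rewrite /c.
    have [v0 vY vD _] := vP i w; have [v0' vY' _ _] := vP j w.
    have [<-|ij] := eqVneq i j; last exact: ler_pM.
    exact: ler_pM.
  rewrite /Z sqrrB1 exprMn -exprVn.
  set S := \sum_(i < n) v i w in sL sc *.
  have n2 : (0 : R) <= n%:R^-1 ^+ 2 by rewrite sqr_ge0.
  have n1 : (0 : R) <= n%:R^-1 by rewrite invr_ge0 ltW.
  have := ler_wpM2l n2 sc; have := ler_wpM2l n1 sL; lra.
apply: le_trans (prob_le_expectation mA EZ _ _) _.
- by move=> w; apply: le_trans (ZW w); exact: sqr_ge0.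
(* On A every truncated term vanishes, so W = 0 and (W-1)^2 = 1. *)
- move=> w Aw; apply: le_trans (ZW w).
  rewrite big1 ?mulr0 ?sub0r ?sqrrN ?expr1n// => i _.
  by rewrite /v ltNge AX.
rewrite lee_fin sumr_const card_ord.
have : \sum_(i < n) \sum_(j < n) bb i j <= n%:R * D + n%:R ^+ 2 * expR r.
  apply: (@le_trans _ _ (\sum_(i < n) (D + n%:R * expR r))).
    apply: ler_sum => i _.
    apply: (@le_trans _ _ (\sum_(j < n) ((if i == j then D else 0) + expR r))).
      by apply: ler_sum => j _.
    rewrite big_split /= sumr_const card_ord -(mulr_natl (expR r) n) lerD2r.
    by rewrite -big_mkcond (big_pred1 i)// => j; rewrite /= eq_sym.
  by rewrite sumr_const card_ord -mulr_natl; lra.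
set SS := \sum_(i < n) _ => hSS.
have : (n%:R ^+ 2)^-1 * SS <= (n%:R ^+ 2)^-1 * (n%:R * D + n%:R ^+ 2 * expR r).
  by rewrite ler_wpM2l// invr_ge0 sqr_ge0.
have -> : (n%:R ^+ 2)^-1 * (n%:R * D + n%:R ^+ 2 * expR r) = D / n%:R + expR r.
  by field; rewrite gt_eqF.
have -> : - (2 / n%:R) * ((1 - 2 * dl) *+ n) = - 2 + 4 * dl.
  by rewrite -mulr_natl; field; rewrite gt_eqF.
rewrite -/D -/dl; lra.
Qed.

End SecondMoment.

Lemma natr_dist_ge1 (R : realDomainType) (m n : nat) :
  m != n -> 1 <= `|m%:R - n%:R| :> R.
Proof.
wlog nm : m n / (n < m)%N.
  move=> hw; case: (ltngtP m n) => [mn _|nm _|//].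
    by rewrite distrC; apply: hw => //; rewrite gtn_eqF.
  by apply: hw => //; rewrite gtn_eqF.
by move=> _; rewrite -natrB ?(ltnW nm)// normr_nat ler1n subn_gt0.
Qed.

(** The left side is twice the covariance of two increments of lag l at distance x, so their
    correlation is at most (l/|x|)^(2(1-H)). A one-sided bound suffices, as pair expectations
    increase with the correlation. *)
Lemma fbm_kernel_second_difference (R : realType) (H x l : R) :
  0 < H < 1 -> 0 < l <= `|x| ->
  fbm_kernel H (x + l) + fbm_kernel H (x - l) - 2 * fbm_kernel H x
    <= 2 * ((l / `|x|) `^ (2 * (1 - H)) * fbm_kernel H l).
Proof.
move=> H01 /andP[l0 lx]; have /andP[H0 H1] := H01.
wlog x0 : x lx / 0 < x.
  move=> hw; have [x0|x0|x0] := ltgtP 0 x; first exact: hw.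
    have := hw (- x); rewrite normrN oppr_gt0 => /(_ lx x0).
    have -> : fbm_kernel H (- x + l) = fbm_kernel H (x - l).
      by rewrite /fbm_kernel -normrN opprD opprK.
    have -> : fbm_kernel H (- x - l) = fbm_kernel H (x + l).
      by rewrite /fbm_kernel -normrN opprD !opprK.
    have -> : fbm_kernel H (- x) = fbm_kernel H x by rewrite /fbm_kernel normrN.
    by rewrite [fbm_kernel H (x - l) + _]addrC.
  by move: lx; rewrite -x0 normr0 leNgt l0.
rewrite gtr0_norm// in lx *; pose y := l / x.
have y0 : 0 < y by rewrite divr_gt0.
have y1 : y <= 1 by rewrite ler_pdivrMr// mul1r.
have lE : l = y * x by rewrite /y divfK ?gt_eqF.
have kE z : 0 <= 1 + z -> fbm_kernel H (x * (1 + z))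
    = x `^ (2 * H) * (1 + (2 * z + z ^+ 2)) `^ H.
  move=> z0; rewrite /fbm_kernel ger0_norm; last by rewrite mulr_ge0// ltW.
  rewrite powRM ?(ltW x0)//; congr (_ * _).
  by rewrite powRrM powR_mulrn//; congr (_ `^ _); ring.
have yl : 1 + y >= 0 by lra.
have yr : 1 + (- y) >= 0 by lra.
have -> : x + l = x * (1 + y) by rewrite lE; ring.
have -> : x - l = x * (1 + (- y)) by rewrite lE; ring.
rewrite !kE//.
have -> : fbm_kernel H x = x `^ (2 * H) by rewrite /fbm_kernel gtr0_norm.
have -> : y `^ (2 * (1 - H)) * fbm_kernel H l = x `^ (2 * H) * y ^+ 2.
  rewrite /fbm_kernel gtr0_norm// lE powRM ?(ltW y0) ?(ltW x0)//.
  rewrite mulrA -gt0_powRD// mulrC; congr (_ * _).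
  have -> : 2 * (1 - H) + 2 * H = 2%:R by ring.
  by rewrite powR_mulrn// ltW.
(* (1 +- y)^(2H) = (1 +- 2y + y^2)^H, and u |-> (1 + u)^H lies below its tangent. *)
set X := x `^ _; have X0 : 0 <= X by apply: powR_ge0.
have b1 := @powR_concave_tangent R H (2 * y + y ^+ 2) H01.
have b2 := @powR_concave_tangent R H (2 * - y + (- y) ^+ 2) H01.
have y2 : 0 <= y ^+ 2 by apply: sqr_ge0.
have c1 : -1 <= 2 * y + y ^+ 2 by lra.
have c2 : -1 <= 2 * - y + (- y) ^+ 2 by have := sqr_ge0 (1 - y); rewrite sqrrN; lra.
have := ler_wpM2l X0 (lerD (b1 c1) (b2 c2)).
have := ler_wpM2l X0 (ler_wpM2r y2 (ltW H1)).
rewrite sqrrN; lra.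
Qed.

Section FarIncrements.
Context {d : measure_display} {T : measurableType d} {R : realType}.
Context {P : probability T R} {H : R} {B : R -> {RV P >-> R}}.
Hypothesis H_gt0 : 0 < H.
Hypothesis H_lt1 : H < 1.
Hypothesis fbmB : fractional_brownian_motion H B.

Local Notation h := (fbm_kernel H).

Lemma measurable_increments_small (n : nat) (D l c : R) :
  measurable [set w | forall i : 'I_n,
    B (i.+1%:R * D) w - B (i.+1%:R * D - l) w <= c].
Proof.
have -> : [set w | forall i : 'I_n,
    B (i.+1%:R * D) w - B (i.+1%:R * D - l) w <= c] = \bigcap_(i in [set: 'I_n])
    ~` [set w | c < B (i.+1%:R * D) w - B (i.+1%:R * D - l) w].
  apply/seteqP; split => w /= Aw; first by move=> i _ /=; apply/negP; rewrite -leNgt.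
  by move=> i; rewrite leNgt; apply/negP; exact: Aw.
apply: fin_bigcap_measurable; first exact: finite_finset.
by move=> i _; apply: measurableC; exact: fbm_measurable_gt.
Qed.

(** An instance of [prob_all_small] for increments divided by l^H: distinct times are at least D
    apart, so r is a^2 times the correlation bound at distance D. *)
Lemma prob_increments_small (n : nat) (D l a e : R) :
  (0 < n)%N -> 0 < l <= D -> 0 < a -> 0 < e < 1 ->
  (P [set w | forall i : 'I_n,
    (B (i.+1%:R * D) w - B (i.+1%:R * D - l) w <= (1 - e) * a * l `^ H)%R]
   <= (expR (a ^+ 2 * (l / D) `^ (2 * (1 - H))) - 1
    + expR ((1 / 2 + e) * a ^+ 2) / n%:R
    + 4 * expR (- (e ^+ 2 * a ^+ 2 / 2)))%:E)%E.
Proof.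
move=> n0 /andP[l0 lD] a0 /andP[e0 e1].
have D0 : 0 < D by lra.
have lH : 0 < l `^ H by rewrite powR_gt0.
have hl : h l = (l `^ H) ^+ 2.
  by rewrite /fbm_kernel gtr0_norm// mulrC powRrM powR_mulrn// ltW.
pose t (i : 'I_n) : R := i.+1%:R * D.
pose X (i : 'I_n) w := (B (t i) w - B (t i - l) w) / l `^ H.
have H01 : 0 < H < 1 by rewrite H_gt0.
apply: (@prob_all_small _ _ _ P n X a e) => //; last first.
- by move=> w Aw i; rewrite /X ler_pdivrMr//; exact: Aw.
- exact: measurable_increments_small.
- move=> i j ij; pose x := t i - t j.
  have xD : D <= `|x|.
    rewrite /x /t -mulrBl normrM [X in _ * X]gtr0_norm// ler_peMl ?(ltW D0)//.
    by rewrite natr_dist_ge1// eqSS (inj_eq val_inj).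
  have x0 : 0 < `|x| by apply: lt_le_trans xD.
  have := fbm_increment_expR H_gt0 fbmB (t i) (t i - l) (t j) (t j - l)
    (a / l `^ H) (a / l `^ H).
  have -> : t i - (t i - l) = l by ring.
  have -> : t j - (t j - l) = l by ring.
  have -> : t i - (t j - l) = x + l by rewrite /x; ring.
  have -> : t i - l - t j = x - l by rewrite /x; ring.
  have -> : t i - l - (t j - l) = x by rewrite /x; ring.
  rewrite -/x; set bb := _ / 2 => Eb; exists bb; last first.
    move: Eb; congr (has_expectation P _ _); apply/funext => w; congr expR.
    by rewrite /X; ring.
  rewrite /bb.
  have lx : 0 < l <= `|x| by rewrite l0 (le_trans lD).
  have h1 := fbm_kernel_second_difference H01 lx.
  have h2 : (l / `|x|) `^ (2 * (1 - H)) <= (l / D) `^ (2 * (1 - H)).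
    apply: ge0_ler_powR; rewrite ?nnegrE ?divr_ge0 ?(ltW l0) ?(ltW D0)//.
      by rewrite mulr_ge0// subr_ge0 ltW.
    by rewrite ler_pM2l// lef_pV2 ?posrE.
  have h3 : h (x + l) + h (x - l) - 2 * h x
      <= 2 * ((l / D) `^ (2 * (1 - H)) * h l).
    by apply: (le_trans h1); rewrite ler_pM2l// ler_wpM2r// powR_ge0.
  have al : 0 <= (a / l `^ H) ^+ 2 by rewrite sqr_ge0.
  have := ler_wpM2l al h3.
  have := mulfV (lt0r_neq0 lH).
  have hle : (a / l `^ H) ^+ 2 * h l = a ^+ 2 by rewrite hl; field; rewrite gt_eqF.
  have -> : (a / l `^ H) ^+ 2 * (2 * ((l / D) `^ (2 * (1 - H)) * h l))
    = 2 * ((l / D) `^ (2 * (1 - H)) * ((a / l `^ H) ^+ 2 * h l)) by ring.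
  rewrite -expr2 hle; lra.
- move=> i b; have := fbm_expR H_gt0 fbmB (t i) (t i - l) (b / l `^ H).
  have -> : t i - (t i - l) = l by ring.
  rewrite hl; have -> : (b / l `^ H) ^+ 2 * (l `^ H) ^+ 2 / 2 = b ^+ 2 / 2.
    by field; rewrite gt_eqF.
  by congr (has_expectation P _ _); apply/funext => w; congr expR; rewrite /X; ring.
Qed.

End FarIncrements.

Lemma powRN_near0 (R : realType) (p K v : R) : 0 < p -> 0 < v ->
  \forall n \near \oo, K * n.+2%:R `^ (- p) < v.
Proof.
move=> p0 v0; have [N hN] := powRN_archimedean `|K| p0 v0.
exists N => // n /= Nn; apply: le_lt_trans hN.
apply: (@le_trans _ _ (`|K| * n.+2%:R `^ (- p))).
  by rewrite ler_wpM2r ?powR_ge0// ler_norm.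
rewrite ler_wpM2l// !powRN lef_pV2 ?posrE ?powR_gt0//.
by rewrite ge0_ler_powR ?nnegrE ?(ltW p0)// ler_nat ltnS leqW.
Qed.

Section StorageLower.
Context {d : measure_display} {T : measurableType d} {R : realType}.
Context {P : probability T R} {H : R} {B : R -> {RV P >-> R}}.
Hypothesis H_gt0 : 0 < H.
Hypothesis H_lt1 : H < 1.
Hypothesis fbmB : fractional_brownian_motion H B.

Local Notation beta := (2 * (1 - H))^-1.

(** Block n takes N = n+2 times spaced by N^e. They lie below N^(1+e), hence the factor 1+e in the
    level [u]; they lie above N^e, so the blocks move off to infinity. *)
Lemma storage_block (g : R) : 0 < g < 2 / const_A H ^+ 2 ->
  exists2 e : R, 0 < e & exists A : nat -> set T,
  [/\ forall n, measurable (A n),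
      forall v, 0 < v -> \forall n \near \oo, (P (A n) <= v%:E)%E &
      forall n w, ~ A n w -> exists2 t, n.+2%:R `^ e <= t &
        (((g * ln t) `^ beta)%:E <= storage B t w)%E].
Proof.
have H01 : 0 < H < 1 by rewrite H_gt0.
have A0 := const_A_gt0 H01; have A20 : 0 < const_A H ^+ 2 by rewrite exprn_gt0.
pose k : R := 2 * (1 - H).
have k0 : 0 < k by rewrite mulr_gt0// subr_gt0.
have b0 : 0 < beta by rewrite invr_gt0.
move=> /andP[g0]; rewrite ltr_pdivlMr// => Ag.
pose c : R := const_A H ^+ 2 * g / 2.
have c0 : 0 < c by rewrite divr_gt0// mulr_gt0.
have c1 : c < 1 by rewrite /c [_ * g]mulrC; lra.
(* Small enough for [th] < 1, which makes the diagonal term exp((1/2 + e) a^2) / N = N^(th - 1)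
   vanish. *)
pose e : R := (1 - c) / 8.
have e0 : 0 < e by rewrite /e; lra.
have e1 : e < 1 by rewrite /e; lra.
have f0 : 0 < 1 - e by lra.
(* Chosen so that a^2 = mu ln N. *)
pose mu : R := const_A H ^+ 2 * g * (1 + e) / (1 - e) ^+ 2.
have mu0 : 0 < mu.
  have e10 : 0 < 1 + e by lra.
  apply: divr_gt0; last by rewrite exprn_gt0.
  by apply: mulr_gt0 => //; apply: mulr_gt0.
pose th : R := (1 / 2 + e) * mu.
have th1 : th < 1.
  have -> : th = c * ((1 + e) * (1 + 2 * e)) / (1 - e) ^+ 2.
    by rewrite /th /mu /c; field; rewrite gt_eqF.
  rewrite ltr_pdivrMr ?exprn_gt0// mul1r.
  have -> : c = 1 - 8 * e by rewrite /e; field.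
  have : 0 < e ^+ 2 by rewrite exprn_gt0.
  have : 0 < e ^+ 3 by rewrite exprn_gt0.
  lra.
pose r0 : R := H / (1 - H).
have r00 : 0 < r0 by rewrite divr_gt0// subr_gt0.
pose N (n : nat) : R := n.+2%:R.
pose L n := ln (N n).
pose u n := (g * (1 + e) * L n) `^ beta.
pose D n := N n `^ e.
pose l n := r0 * u n.
pose a n := const_A H * u n `^ (1 - H) / (1 - e).
have N0 n : 0 < N n by [].
have L0 n : 0 < L n by rewrite ln_gt0// ltr1n.
have gL0 n : 0 < g * (1 + e) * L n by rewrite !mulr_gt0// addr_gt0.
have u0 n : 0 < u n by rewrite powR_gt0.
have D0 n : 0 < D n by rewrite powR_gt0.
have l0 n : 0 < l n by rewrite mulr_gt0.
have a0 n : 0 < a n by rewrite divr_gt0// mulr_gt0// powR_gt0.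
have uk n : u n `^ k = g * (1 + e) * L n.
  by rewrite /u -powRrM mulVf ?powRr1 ?(ltW (gL0 n))// gt_eqF.
have a2 n : a n ^+ 2 = mu * L n.
  have u2 : (u n `^ (1 - H)) ^+ 2 = g * (1 + e) * L n.
    by rewrite -powR_mulrn ?powR_ge0// -powRrM mulrC uk.
  by rewrite /a expr_div_n exprMn u2 /mu; field; rewrite gt_eqF.
have small : forall p K v : R, 0 < p -> 0 < v ->
    \forall n \near \oo, K * N n `^ (- p) < v by move=> *; exact: powRN_near0.
have LN n s : 0 < s -> L n <= s^-1 * N n `^ s by move=> s0; exact: ln_le_powR.
(* A logarithm costs a factor N^s / s. Against (N^e)^(-k) = N^(-4s), one logarithm leaves N^(-3s)
   for the correlations and a second one N^(-2s) after multiplication by a^2. *)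
pose s := e * k / 4.
have s0 : 0 < s by rewrite divr_gt0// mulr_gt0.
have ratio n : (l n / D n) `^ k <= r0 `^ k * (g * (1 + e)) / s * N n `^ (- (3 * s)).
  rewrite powRM ?invr_ge0 ?(ltW (l0 n)) ?(ltW (D0 n))//.
  rewrite /l powRM ?(ltW r00) ?(ltW (u0 n))// uk powR_invr ?(ltW (D0 n))//.
  rewrite /D -powRrM -powRN.
  have -> : - (3 * s) = s + - (e * k) by rewrite /s; field.
  rewrite gt0_powRD//.
  have -> : r0 `^ k * (g * (1 + e)) / s * (N n `^ s * N n `^ (- (e * k)))
    = r0 `^ k * (g * (1 + e) * (s^-1 * N n `^ s)) * N n `^ (- (e * k)) by ring.
  rewrite ler_wpM2r ?powR_ge0// ler_wpM2l ?powR_ge0//.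
  by rewrite ler_wpM2l ?LN// mulr_ge0 ?(ltW g0)// addr_ge0// ltW.
exists e => //; pose A n := [set w | forall i : 'I_n.+2,
  B (i.+1%:R * D n) w - B (i.+1%:R * D n - l n) w <= (1 - e) * a n * l n `^ H].
exists A; split.
- by move=> n; exact: measurable_increments_small.
- move=> v v0; pose C := r0 `^ k * (g * (1 + e)) / s.
  have C0 : 0 <= C.
    rewrite /C divr_ge0 ?(ltW s0)// mulr_ge0 ?powR_ge0//.
    by rewrite mulr_ge0 ?(ltW g0)// addr_ge0 ?(ltW e0).
  have v3 : 0 < v / 3 by rewrite divr_gt0.
  have v12 : 0 < v / 12 by rewrite divr_gt0.
  have lv : 0 < ln (1 + v / 3) by rewrite ln_gt0// ltrDl.
  have s3 : 0 < 3 * s by rewrite mulr_gt0.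
  have s2 : 0 < 2 * s by rewrite mulr_gt0.
  have t1 : 0 < 1 - th by rewrite subr_gt0.
  have t2 : 0 < e ^+ 2 * mu / 2 by rewrite divr_gt0// mulr_gt0// exprn_gt0.
  near=> n.
  have h1 : C * N n `^ (- (3 * s)) < 1 by near: n; exact: small.
  have h2 : mu / s * C * N n `^ (- (2 * s)) < ln (1 + v / 3).
    by near: n; exact: small.
  have h3 : 1 * N n `^ (- (1 - th)) < v / 3 by near: n; exact: small.
  have h4 : 1 * N n `^ (- (e ^+ 2 * mu / 2)) < v / 12 by near: n; exact: small.
  have lD : 0 < l n <= D n.
    rewrite l0 /= -[leRHS]mul1r -ler_pdivrMr// leNgt; apply/negP => lD1.
    have := lt_le_trans (le_lt_trans (ratio n) h1).
    have e01 : 0 < l n / D n by rewrite divr_gt0.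
    move=> /(_ 1 (lexx _)); apply/negP; rewrite -leNgt.
    rewrite -(powRr0 (l n / D n)) ler_powR ?(ltW lD1)// ltW//.
  apply: le_trans (prob_increments_small H_gt0 H_lt1 fbmB _ lD (a0 n) _) _ => //.
    by rewrite e0.
  rewrite lee_fin -/k a2.
  have r_le : mu * L n * (l n / D n) `^ k <= ln (1 + v / 3).
    apply: le_trans (ltW h2).
    have -> : - (2 * s) = s + - (3 * s) by ring.
    rewrite gt0_powRD//.
    have -> : mu / s * C * (N n `^ s * N n `^ (- (3 * s)))
      = mu * (s^-1 * N n `^ s) * (C * N n `^ (- (3 * s))) by ring.
    apply: ler_pM.
    + by rewrite mulr_ge0 ?(ltW mu0) ?(ltW (L0 n)).
    + exact: powR_ge0.
    + by rewrite ler_pM2l// LN.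
    + exact: ratio.
  have x1 : expR (mu * L n * (l n / D n) `^ k) <= 1 + v / 3.
    by rewrite -[leRHS]lnK ?posrE ?addr_gt0// ler_expR.
  have x2 : expR ((1 / 2 + e) * (mu * L n)) / n.+2%:R = N n `^ (- (1 - th)).
    rewrite -{1}[n.+2%:R](@lnK R) ?posrE// -expRN -expRD /powR gt_eqF//.
    by congr expR; rewrite -/(N n) -/(L n) /th; ring.
  have x3 : expR (- (e ^+ 2 * (mu * L n) / 2)) = N n `^ (- (e ^+ 2 * mu / 2)).
    by rewrite /powR gt_eqF//; congr expR; rewrite -/(L n); ring.
  rewrite x2 x3; lra.
- move=> n w /existsNP[i]; move=> /negP; rewrite -ltNge => iw.
  exists (i.+1%:R * D n).
    by rewrite -/(N n) -/(D n) ler_peMl ?(ltW (D0 n))// ler1n.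
  set t := i.+1%:R * D n in iw *.
  have t1 : 1 <= t.
    apply: (@le_trans _ _ (D n)); last by rewrite ler_peMl ?(ltW (D0 n))// ler1n.
    by rewrite /D -(powRr0 (N n)) ler_powR ?(ltW e0)// ler1n.
  apply: (@le_trans _ _ (u n)%:E).
    rewrite lee_fin; apply: ge0_ler_powR; rewrite ?nnegrE ?(ltW b0) ?(ltW (gL0 n))//.
      by rewrite mulr_ge0 ?(ltW g0)// ln_ge0.
    rewrite -mulrA ler_pM2l//.
    have -> : (1 + e) * L n = ln (N n `^ (1 + e)) by rewrite ln_powR.
    rewrite ler_ln ?posrE ?powR_gt0//; last by lra.
    rewrite gt0_powRD// powRr1 ?(ltW (N0 n))// ler_pM2r//.
    by rewrite ler_nat ltn_ord.
  apply: (@le_trans _ _ (B t w - B (t - l n) w - (t - (t - l n)))%:E).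
    rewrite lee_fin.
    (* The lag [l] is the optimal one, so the threshold is exactly the level plus the drift over the
       lag. *)
    have lE : (1 - e) * a n * l n `^ H = u n + l n.
      rewrite /l const_A_eq// /a; congr (_ * _ `^ _).
      by rewrite mulrC divfK// gt_eqF.
    rewrite lE in iw; lra.
  apply: ereal_sup_ubound; exists (t - l n) => //=.
  by rewrite gerBl ltW.
Unshelve. all: by end_near. Qed.

(** Failure in all blocks from N on is contained in each single failure event, whose probabilities
    tend to 0; so almost surely some block beyond any N succeeds. *)
Lemma storage_lower (g : R) : 0 < g < 2 / const_A H ^+ 2 ->
  P.-negligible [set w | ~ forall t0 : R, exists2 t, t0 <= t &
    (((g * ln t) `^ beta)%:E <= storage B t w)%E].
Proof.
move=> /storage_block[e e0 [A [mA PA hA]]].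
pose F N := \bigcap_n A (N + n)%N.
have mF N : measurable (F N) by apply: bigcapT_measurable.
apply: (@negligibleS _ _ _ _ (\bigcup_N F N)); last first.
  apply: negligible_bigcup => N.
  suff PF0 : P (F N) = 0%E by exact/negligibleP.
  rewrite -(@fineK _ (P (F N))) ?fin_num_measure//; congr (_%:E); apply/eqP.
  rewrite eq_le fine_ge0// andbT leNgt; apply/negP => v0.
  have v2 : 0 < fine (P (F N)) / 2 by rewrite divr_gt0.
  have [M _ hM] := PA _ v2.
  have := hM (N + M)%N (leq_addl _ _).
  rewrite leNgt => /negP; apply.
  apply: (@lt_le_trans _ _ (P (F N))).
    by rewrite -[ltRHS](@fineK _ (P (F N))) ?fin_num_measure// lte_fin; lra.
  apply: le_measure; rewrite ?inE//.
  exact: bigcap_inf.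
move=> w wS; apply: contrapT => wF; apply: wS => t0.
(* From this block on, all times exceed |t0|. *)
pose N := Num.truncn (`|t0| `^ e^-1).
have : ~ F N w by move=> FN; apply: wF; exists N.
move=> /existsNP[n /not_implyP[_ /hA[t tn ht]]].
exists t => //; apply: le_trans tn; apply: le_trans (ler_norm t0) _.
have -> : `|t0| = (`|t0| `^ e^-1) `^ e by rewrite -powRrM mulVf ?powRr1// gt_eqF.
apply: ge0_ler_powR; rewrite ?nnegrE ?powR_ge0 ?(ltW e0)//.
apply: (le_trans (ltW (truncnS_gt _))).
by rewrite ler_nat ltnS (leq_trans (leq_addr n N))// leqW.
Qed.

End StorageLower.

(** * Passage to the limit superior *)

Lemma limf_esup_pinfty_le (R : realType) (f : R -> \bar R) (t0 : R) (x : \bar R) :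
  (forall t, t0 <= t -> (f t <= x)%E) -> (limf_esup f +oo%R <= x)%E.
Proof.
move=> fx; rewrite limf_esupE.
apply: (@le_trans _ _ (ereal_sup (f @` [set t | t0 <= t]))).
  apply: ereal_inf_lbound; exists [set t | t0 <= t] => //.
  exact: nbhs_pinfty_ge (num_real _).
by apply: ge_ereal_sup => _ [t /= t0t <-]; exact: fx.
Qed.

Lemma limf_esup_pinfty_ge (R : realType) (f : R -> \bar R) (x : \bar R) :
  (forall t0, exists2 t, t0 <= t & (x <= f t)%E) -> (x <= limf_esup f +oo%R)%E.
Proof.
move=> fx; rewrite limf_esupE; apply: le_ereal_inf_tmp => _ [V [M [_ MV]] <-].
have [t tM xt] := fx (M + 1).
apply: (le_trans xt); apply: ereal_sup_ubound; exists t => //.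
by apply: MV; apply: lt_le_trans tM; rewrite ltrDl.
Qed.

(** Raising to the power 1/b turns the bounds into linear ones around c. Indexing by naturals keeps
    the exceptional events countable in number. *)
Lemma powR_sandwich (R : realType) (c b : R) (x : \bar R) : 0 < c -> 0 < b ->
  (forall m : nat, (((c * (1 - m.+2%:R^-1)) `^ b)%:E <= x)%E /\
     (x <= ((c * (1 + m.+1%:R^-1)) `^ b)%:E)%E) -> x = (c `^ b)%:E.
Proof.
move=> c0 b0; case: x => [x|h|h]; last 2 first.
- by have [_] := h 0%N; rewrite leye_eq.
- by have [] := h 0%N; rewrite leeNy_eq.
move=> h; have x0 : 0 <= x.
  by have [+ _] := h 0%N; rewrite lee_fin; apply: le_trans; exact: powR_ge0.
have binv y : 0 <= y -> (y `^ b) `^ b^-1 = y.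
  by move=> y0; rewrite -powRrM mulfV ?powRr1// gt_eqF.
have bi0 : 0 <= b^-1 by rewrite invr_ge0 ltW.
pose z := x `^ b^-1.
suff zc : z = c by rewrite -zc /z -powRrM mulVf ?powRr1// gt_eqF.
apply/eqP; rewrite -subr_eq0 -normr_eq0; apply/eqP/le_anti.
rewrite normr_ge0 andbT leNgt; apply/negP => e0.
(* This index makes c/(m+1) smaller than the supposed gap e. *)
set e := `|z - c| in e0; pose m := Num.truncn (c / e).
have ce : c * m.+1%:R^-1 < e.
  by rewrite ltr_pdivrMr// mulrC -ltr_pdivrMr// truncnS_gt.
have cm : c * m.+2%:R^-1 <= c * m.+1%:R^-1.
  by rewrite ler_pM2l// lef_pV2 ?posrE// ler_nat.
have [] := h m; rewrite !lee_fin => xl xr.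
have m1 : 0 <= 1 - m.+2%:R^-1 :> R by rewrite subr_ge0 invf_le1// ler1n.
have lz : c * (1 - m.+2%:R^-1) <= z.
  rewrite -[leLHS]binv ?mulr_ge0 ?(ltW c0)//.
  by apply: ge0_ler_powR; rewrite ?nnegrE ?powR_ge0.
have rz : z <= c * (1 + m.+1%:R^-1).
  rewrite -[leRHS]binv ?mulr_ge0 ?(ltW c0) ?addr_ge0//.
  by apply: ge0_ler_powR; rewrite ?nnegrE ?powR_ge0.
have aux (y p q : R) : c * (1 - p) <= y -> y <= c * (1 + q) -> c * p <= c * q ->
    - (c * q) <= y - c <= c * q.
  by move=> *; apply/andP; split; lra.
have : e <= c * m.+1%:R^-1 by rewrite /e ler_norml; exact: aux lz rz cm.
by rewrite leNgt ce.
Qed.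

Theorem corollary1 (R : realType) (d : measure_display)
    (T : measurableType d) (P : probability T R)
    (H : R) (H_gt0 : 0 < H) (H_lt1 : H < 1)
    (B : R -> {RV P >-> R}) (fbmB : fractional_brownian_motion H B) :
  {ae P, forall w : T,
    limf_esup
      (fun t : R => (storage B t w / (ln t `^ (2 * (1 - H))^-1)%:E)%E) +oo%R
    = ((2 / const_A H ^+ 2) `^ (2 * (1 - H))^-1)%:E}.
Proof.
have H01 : 0 < H < 1 by rewrite H_gt0.
set c := 2 / const_A H ^+ 2; set b := (2 * (1 - H))^-1.
have c0 : 0 < c by rewrite divr_gt0// exprn_gt0// const_A_gt0.
have b0 : 0 < b by rewrite invr_gt0 mulr_gt0// subr_gt0.
pose g1 m : R := c * (1 - m.+2%:R^-1); pose g2 m : R := c * (1 + m.+1%:R^-1).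
have g1P m : 0 < g1 m < c.
  rewrite mulr_gt0 ?subr_gt0 ?invf_lt1 ?ltr1n//=.
  by rewrite -[ltRHS]mulr1 ltr_pM2l// gtrBl.
have g2P m : c < g2 m by rewrite -[ltLHS]mulr1 ltr_pM2l// ltrDl.
have := negligible_bigcup (fun m => negligibleU
  (storage_lower H_gt0 H_lt1 fbmB (g1P m))
  (storage_upper H_gt0 H_lt1 fbmB (g2P m))).
apply: negligibleS => w /= wP; apply: contrapT => wN; apply: wP.
(* Beyond 2 the logarithm is positive, so the quotient can be cleared by multiplication. *)
have ln_pos (t : R) : 2 <= t -> 0 < ln t `^ b.
  by move=> t2; rewrite powR_gt0// ln_gt0//; lra.
have split g t : 0 <= g -> 2 <= t -> (g * ln t) `^ b = g `^ b * ln t `^ b.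
  by move=> g0 t2; rewrite powRM// ln_ge0//; lra.
apply: powR_sandwich => // m; split.
- have hm : forall t0 : R, exists2 t, t0 <= t &
      (((g1 m * ln t) `^ b)%:E <= storage B t w)%E.
    by apply: contrapT => hm; apply: wN; exists m => //; left.
  apply: limf_esup_pinfty_ge => t0.
  have [t] := hm (Num.max t0 2); rewrite ge_max => /andP[t0t t2] ht.
  exists t => //; rewrite inver gt_eqF ?ln_pos//= lee_pdivlMr ?ln_pos// -EFinM -split//.
  by have /andP[/ltW] := g1P m.
- have [t0 ht] : exists t0 : R, forall t, t0 <= t ->
      (storage B t w <= ((g2 m * ln t) `^ b)%:E)%E.
    by apply: contrapT => hm; apply: wN; exists m => //; right.
  apply: (@limf_esup_pinfty_le _ _ (Num.max t0 2)) => t.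
  rewrite ge_max => /andP[t0t t2].
  rewrite inver gt_eqF ?ln_pos//= lee_pdivrMr ?ln_pos// -EFinM -split//; first exact: ht.
  exact: ltW (lt_trans c0 (g2P m)).
Qed.
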